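(* Let $K$ be a unital commutative $\mathbb{Q}$-algebra, $n\ge1$, $\alpha\ge 1$, $\emptyset\ne W\subseteq\mathbb{N}^+$, and $F_t(z)=z-H_t(z)\in\mathbb{A}_t^{[\alpha]}\langle\langle z\rangle\rangle$ with $H_t(z)=\sum_{m\in W}t^mH_{[m]}(z)$ for some $H_{[m]}(z)\in K\langle\langle z\rangle\rangle^{\times n}$. Then the linear map $\mathcal{A}_{F_t}:\mathcal{H}_{GL}^W\to\mathcal{D}^{[\alpha]}\langle\langle z\rangle\rangle$, $T\mapsto D_T$ ($T\in\bar{\mathbb{T}}^W$), is a homomorphism of $K$-Hopf algebras.
   Context: $z=(z_1,\dots,z_n)$ are free variables, all commutative or all noncommutative (both cases); $K\langle\langle z\rangle\rangle$ the formal power series algebra; $t$ a central formal parameter. For $u\in K\langle\langle z\rangle\rangle^{\times n}$, $[u\,\partial/\partial z]$ is the $K$-derivation sending $z_i\mapsto u_i$. $\mathcal{D}^{[\alpha]}\langle\langle z\rangle\rangle$ is the unital subalgebra of $\mathrm{End}_K(K\langle\langle z\rangle\rangle)$ generated by the $K$-derivations increasing degree in $z$ by at least $\alpha-1$; it is a Hopf algebra (as enveloping algebra of that Lie algebra of derivations) with each such derivation $\delta$ primitive: $\Delta\delta=1\otimes\delta+\delta\otimes1$, $S(\delta)=-\delta$. $\mathbb{A}_t^{[\alpha]}\langle\langle z\rangle\rangle$: $K[[t]]$-automorphisms $F_t=z-H_t$ of $K[[t]]\langle\langle z\rangle\rangle$ with $o(H_t)\ge\alpha$ in $z$ and $H_{t=0}=0$.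 $B_+$ on derivations: with extra free variables $w=(w_1,\dots,w_n)$ of the same kind, for $\delta_i=[v_i(z)\partial/\partial z]$, $B_+(\delta_1,\dots,\delta_k)u(z):=[v_1(w)\partial/\partial z]\cdots[v_k(w)\partial/\partial z]u(z)|_{w=z}$, where $[v(w)\partial/\partial z]$ sends $z_i\mapsto v_i(w)$, $w_j\mapsto0$. Trees: $W$-labeled rooted trees (vertices labeled in $W$, isomorphisms preserve root and labels), $\mathbb{T}^W$ their nonempty isomorphism classes; $|T|$ is the sum of labels, $v(T)$ the number of vertices. $B_+(T_1,\dots,T_k)$ adds a new root labeled $0$ (weight $0$) joined to the roots of the $T_i$; $\bar{\mathbb{T}}^W$ is the set of all such trees ($k\ge0$; $k=0$ gives the singleton $\circ$). Grossman–Larson Hopf algebra $\mathcal{H}_{GL}^W$: $K$-span of $\bar{\mathbb{T}}^W$; for $T=B_+(T_1,\dots,T_k)$, $S\in\bar{\mathbb{T}}^W$, $T\cdot S$ is the sum of the trees obtained by joining each root of $T_1,\dots,T_k$ by an edge to some vertex of $S$, over all $v(S)^k$ choices; unit $\circ$; $\Delta(T)=\sum_{I\sqcup J=\{1,\dots,k\}}B_+(T_I)\otimes B_+(T_J)$ where $B_+(T_I)$ is $B_+$ of the $T_i$, $i\in I$ ($B_+(T_\emptyset)=\circ$); counit kills all trees except $\circ$; graded by $|T|$. $P_T$ for $T\in\mathbb{T}^W$ with root labeled $m$: $P_T=H_{[m]}$ if $T$ is a single vertex, else $P_T=B_+([P_{T_1}\partial/\partial z],\dots,[P_{T_d}\partial/\partial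 z])H_{[m]}$ where $T_1,\dots,T_d$ are the subtrees at the children of the root. For $T=B_+(T_1,\dots,T_d)\in\bar{\mathbb{T}}^W$, $D_T:=B_+([P_{T_1}\partial/\partial z],\dots,[P_{T_d}\partial/\partial z])$, $D_\circ=\mathrm{id}$.
   Formalization: For commuting variables (or n=1) the coproduct with primitive derivations is not well defined on D^[α] inside End; coproduct, counit and antipode of D^[α] are taken as the relations generated by their values on derivations, which are the usual maps whenever the Hopf structure exists. *)

(* Defs.v *)
From HB Require Import structures.
From mathcomp Require Import all_boot all_algebra.
From mathcomp Require Import finmap generic_quotient.
From mathcomp Require Import boolp functions.
From mathcomp Require Import monalg.

Set Implicit Arguments.
Unset Strict Implicit.
Unset Printing Implicit Defensive.

Import GRing.Theory.
Local Open Scope ring_scope.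

Inductive var_kind := Commutative | Noncommutative.

(* A commutative monomial is its exponent vector, a noncommutative one a word. *)
Definition monom (k : var_kind) (I : finType) : choiceType :=
  match k with
  | Commutative => {ffun I -> nat} : choiceType
  | Noncommutative => seq I : choiceType
  end.

Definition monom_of_word (k : var_kind) (I : finType) : seq I -> monom k I :=
  match k return seq I -> monom k I with
  | Commutative => fun w => [ffun i => count_mem i w]
  | Noncommutative => fun w => w
  end.

(* For commutative monomials, the factors are listed in the order of enum I. *)
Definition word_of_monom (k : var_kind) (I : finType) : monom k I -> seq I :=
  match k return monom k I -> seq I with
  | Commutative =>
      fun m : {ffun I -> nat} => flatten [seq nseq (m i) i | i <- enum I]
  | Noncommutative => fun m => m
  end.

Section Series.
Variables (K : comNzRingType) (k : var_kind).

Definition mdegree (I : finType) (m : monom k I) : nat :=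
  size (word_of_monom m).

Definition mmult (I : finType) (m m' : monom k I) : monom k I :=
  monom_of_word k (word_of_monom m ++ word_of_monom m').

Definition monoms_eq (I : finType) (d : nat) : seq (monom k I) :=
  undup [seq monom_of_word k (tval w) | w : d.-tuple I].

Definition monoms_le (I : finType) (d : nat) : seq (monom k I) :=
  flatten [seq monoms_eq I e | e <- iota 0 d.+1].

(* K<<z>>, as families of coefficients; it is a K-module coefficientwise, but
   its product is ps_mul, not the pointwise product of functions. *)
Definition pseries (I : finType) : lmodType K := monom k I -> K^o.

Definition ps_monom (I : finType) (w : seq I) : pseries I :=
  fun m => (m == monom_of_word k w)%:R.

Definition ps_one (I : finType) : pseries I := ps_monom [::].

Definition ps_var (I : finType) (i : I) : pseries I := ps_monom [:: i].

Definition ps_mul (I : finType) (f g : pseries I) : pseries I :=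
  fun m => \sum_(a <- monoms_le I (mdegree m))
             \sum_(b <- monoms_le I (mdegree m) | mmult a b == m)
               (f a : K) * (g b : K).

Definition ord_ge (I : finType) (d : nat) (f : pseries I) : Prop :=
  forall m, (mdegree m < d)%N -> f m = 0.

(* Image of a product of variables under the derivation z_i |-> u_i. *)
Fixpoint vder_word (I : finType) (u : I -> pseries I) (w : seq I) : pseries I :=
  if w is i :: w' then
    ps_mul (u i) (ps_monom w') + ps_mul (ps_var i) (vder_word u w')
  else 0.

(* [u d/dz]. The image of a monomial a has order at least deg a - 1, whence
   the truncation of the sum over all monomials a. *)
Definition vder (I : finType) (u : I -> pseries I) (f : pseries I) : pseries I :=
  fun m => \sum_(a <- monoms_le I (mdegree m).+1)
             (f a : K) * (vder_word u (word_of_monom a) m : K).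

(* Continuous algebra morphism sending the variable i to the variable r i. *)
Definition ps_rename (I J : finType) (r : I -> J) (f : pseries I) : pseries J :=
  fun m => \sum_(a <- monoms_eq I (mdegree m)
                   | monom_of_word k (map r (word_of_monom a)) == m) f a.

Section Operators.
Variable I : finType.

Definition operator : lmodType K := pseries I -> pseries I.

(* In K<<z,w>> the variables z_i and w_i are inl i and inr i. *)
Definition vder_w (v : I -> pseries I) : pseries (I + I)%type -> pseries (I + I)%type :=
  vder (fun x : I + I => match x with
                         | inl i => ps_rename inr (v i)
                         | inr _ => 0
                         end).

(* B_+([v_1 d/dz], ..., [v_k d/dz]), where vs = [:: v_1; ...; v_k]. *)
Definition Bplus_op (vs : seq (I -> pseries I)) : operator := fun u =>
  ps_rename (fun x : I + I => match x with inl i => i | inr i => i end)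
    (foldr vder_w (ps_rename inl u) vs).

Definition derivation (delta : operator) : Prop :=
  (forall (a : K) f g, delta (a *: f + g) = a *: delta f + delta g) /\
  (forall f g, delta (ps_mul f g) =
                 ps_mul (delta f) g + ps_mul f (delta g)).

(* The derivations increasing the degree by at least alpha - 1. *)
Definition derivation_ge (alpha : nat) (delta : operator) : Prop :=
  derivation delta /\
  forall d f, ord_ge d f -> ord_ge (d + alpha - 1) (delta f).

Inductive diffop (alpha : nat) : operator -> Prop :=
| diffop_one : diffop alpha id
| diffop_der delta : derivation_ge alpha delta -> diffop alpha delta
| diffop_lin (a : K) x y :
    diffop alpha x -> diffop alpha y -> diffop alpha (a *: x + y)
| diffop_mul x y : diffop alpha x -> diffop alpha y -> diffop alpha (x \o y).

End Operators.

(* Linear extension of f to the free module on T. *)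
Definition mlin (T : choiceType) (V : lmodType K) (f : T -> V)
    (x : {malg K[T]}) : V :=
  \sum_(t <- msupp x) x@_t *: f t.

Section TensorSquare.
Variable I : finType.
Let op := operator I.

(* Elements of D (x) D, for D = diffop alpha, are represented in the free
   module on pairs of operators; they are identified when all maps that are
   bilinear on D x D agree on them. *)
Definition bilinear_on (D : op -> Prop) (M : lmodType K) (b : op -> op -> M) :=
  (forall (a : K) x x' y, D x -> D x' -> D y ->
     b (a *: x + x') y = a *: b x y + b x' y) /\
  (forall (a : K) x y y', D x -> D y -> D y' ->
     b x (a *: y + y') = a *: b x y + b x y').

Definition tensor_eq (alpha : nat) (s t : {malg K[(op * op)%type]}) : Prop :=
  forall (M : lmodType K) (b : op -> op -> M),
    bilinear_on (@diffop I alpha) b ->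
    mlin (fun p : op * op => b p.1 p.2) s =
    mlin (fun p : op * op => b p.1 p.2) t.

Definition tens (x y : op) : {malg K[(op * op)%type]} := << (x, y) >>.

Definition tensor_mul (s t : {malg K[(op * op)%type]}) :
    {malg K[(op * op)%type]} :=
  mlin (fun p : op * op =>
    mlin (fun q : op * op => tens (p.1 \o q.1) (p.2 \o q.2)) t) s.

(* Graphs of the coproduct, counit and antipode of D = diffop alpha: the
   coproduct and the counit are the algebra morphisms, and the antipode is the
   algebra anti-morphism, with the prescribed values on the generators, so their graphs
   are generated, as subalgebras of D x (D (x) D), D x K and D x D^op, by the
   pairs given by those values. Relations are used because the prescribed
   values need not extend to a function on the algebra D of operators: for one
   variable, e_i = z^(i+1) d/dz satisfy e_0 e_2 - e_1 e_1 - e_2 = 0, while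
   multiplicativity would give this element the coproduct
   e_0 (x) e_2 + e_2 (x) e_0 - 2 e_1 (x) e_1. *)
Inductive coprod_graph (alpha : nat) :
    op -> {malg K[(op * op)%type]} -> Prop :=
| coprod_one : coprod_graph alpha id (tens id id)
| coprod_der delta : derivation_ge alpha delta ->
    coprod_graph alpha delta (tens id delta + tens delta id)
| coprod_lin (a : K) x s y t :
    coprod_graph alpha x s -> coprod_graph alpha y t ->
    coprod_graph alpha (a *: x + y) (a *: s + t)
| coprod_mul x s y t :
    coprod_graph alpha x s -> coprod_graph alpha y t ->
    coprod_graph alpha (x \o y) (tensor_mul s t)
| coprod_eq x s t :
    coprod_graph alpha x s -> tensor_eq alpha s t -> coprod_graph alpha x t.

Inductive counit_graph (alpha : nat) : operator I -> K -> Prop :=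
| counit_one : counit_graph alpha id 1
| counit_der delta : derivation_ge alpha delta -> counit_graph alpha delta 0
| counit_lin (a : K) x c y d :
    counit_graph alpha x c -> counit_graph alpha y d ->
    counit_graph alpha (a *: x + y) (a * c + d)
| counit_mul x c y d :
    counit_graph alpha x c -> counit_graph alpha y d ->
    counit_graph alpha (x \o y) (c * d).

Inductive antipode_graph (alpha : nat) : operator I -> operator I -> Prop :=
| antipode_one : antipode_graph alpha id id
| antipode_der delta : derivation_ge alpha delta ->
    antipode_graph alpha delta (- delta)
| antipode_lin (a : K) x x' y y' :
    antipode_graph alpha x x' -> antipode_graph alpha y y' ->
    antipode_graph alpha (a *: x + y) (a *: x' + y')
| antipode_mul x x' y y' :
    antipode_graph alpha x x' -> antipode_graph alpha y y' ->
    antipode_graph alpha (x \o y) (y' \o x').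

End TensorSquare.

Section Automorphisms.
Variable I : finType.

(* K[[t]]<<z>>, expanded in powers of t. *)
Definition tseries : lmodType K := nat -> pseries I.

Definition ts_one : tseries := fun d => if d is 0 then @ps_one I else 0.

Definition ts_var (i : I) : tseries := fun d => if d is 0 then ps_var i else 0.

Definition ts_mul (f g : tseries) : tseries :=
  fun d => \sum_(i < d.+1) ps_mul (f i) (g (d - i)%N).

(* Multiplication by the scalar \sum_d c_d t^d of K[[t]]. *)
Definition ts_scale (c : nat -> K) (f : tseries) : tseries :=
  fun d => \sum_(i < d.+1) c i *: f (d - i)%N.

Definition Kt_automorphism (phi : tseries -> tseries) : Prop :=
  [/\ bijective phi,
      phi ts_one = ts_one,
      forall f g, phi (ts_mul f g) = ts_mul (phi f) (phi g),
      forall f g, phi (f + g) = phi f + phi g &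
      forall c f, phi (ts_scale c f) = ts_scale c (phi f)].

(* F is the family of the images F_i of the variables z_i. *)
Definition in_At (alpha : nat) (F : I -> tseries) : Prop :=
  [/\ exists2 phi, Kt_automorphism phi & forall i, phi (ts_var i) = F i,
      forall i d, ord_ge alpha ((ts_var i - F i) d) &
      forall i, (ts_var i - F i) 0%N = 0].

Definition Ht (W : pred nat) (H : nat -> I -> pseries I) (i : I) : tseries :=
  fun m => if W m then H m i else 0.

End Automorphisms.
End Series.

(* Plane trees; rooted trees are their isomorphism classes, see rtree. *)
Inductive ptree := PNode of nat & seq ptree.

Definition plabel (T : ptree) : nat := let: PNode m _ := T in m.
Definition pchildren (T : ptree) : seq ptree := let: PNode _ s := T in s.

Fixpoint ptree_encode (T : ptree) : GenTree.tree nat :=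
  let: PNode m s := T in GenTree.Node m (map ptree_encode s).

Fixpoint ptree_decode (T : GenTree.tree nat) : ptree :=
  match T with
  | GenTree.Leaf m => PNode m [::]
  | GenTree.Node m s => PNode m (map ptree_decode s)
  end.

Lemma ptree_encodeK : cancel ptree_encode ptree_decode.
Proof.
rewrite /cancel; fix IH 1 => -[m s] /=; congr PNode; rewrite -map_comp.
by elim: s => [|T s IHs] //=; rewrite IH IHs.
Qed.

HB.instance Definition _ := Countable.copy ptree (can_type ptree_encodeK).

(* Isomorphism of rooted labeled trees: the children may be permuted. *)
Inductive ptree_iso : ptree -> ptree -> Prop :=
| ptree_iso_node m s s' t :
    perm_eq s s' -> pforest_iso s' t -> ptree_iso (PNode m s) (PNode m t)
with pforest_iso : seq ptree -> seq ptree -> Prop :=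
| pforest_iso_nil : pforest_iso [::] [::]
| pforest_iso_cons S T s t :
    ptree_iso S T -> pforest_iso s t -> pforest_iso (S :: s) (T :: t).

Scheme ptree_iso_mind := Minimality for ptree_iso Sort Prop
with pforest_iso_mind := Minimality for pforest_iso Sort Prop.

Lemma ptree_iso_refl T : ptree_iso T T.
Proof.
move: T; fix IH 1 => -[m s]; apply: (@ptree_iso_node m s s) => //.
elim: s => [|T s IHs]; first exact: pforest_iso_nil.
exact: pforest_iso_cons.
Qed.

Lemma pforest_iso_split s t1 t2 : pforest_iso s (t1 ++ t2) ->
  exists s1 s2, [/\ s = s1 ++ s2, pforest_iso s1 t1 & pforest_iso s2 t2].
Proof.
elim: t1 s => [|T t1 IHt] s /= st.
  by exists [::], s; split=> //; exact: pforest_iso_nil.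
inversion st as [|R ? r ? RT rt]; subst.
have [s1 [s2 [-> i1 i2]]] := IHt _ rt.
by exists (R :: s1), s2; split=> //; exact: pforest_iso_cons.
Qed.

Lemma pforest_iso_cat s1 s2 t1 t2 : pforest_iso s1 t1 -> pforest_iso s2 t2 ->
  pforest_iso (s1 ++ s2) (t1 ++ t2).
Proof.
move=> st1 st2; elim: s1 t1 st1 => [|S s IHs] t1 st1; inversion st1; subst => //=.
by apply: pforest_iso_cons => //; exact: IHs.
Qed.

Lemma pforest_iso_perm s t t' : pforest_iso s t -> perm_eq t t' ->
  exists2 s', perm_eq s s' & pforest_iso s' t'.
Proof.
elim: s t t' => [|S s IHs] t t' st; inversion st as [|? T ? u ST su]; subst.
  rewrite perm_sym => /perm_nilP->.
  by exists [::] => //; exact: pforest_iso_nil.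
move=> pt; have Tt' : T \in t' by rewrite -(perm_mem pt) mem_head.
case/splitPr: Tt' pt => t1 t2 pt.
have pu : perm_eq u (t1 ++ t2).
  by move: pt; rewrite perm_sym perm_catC /= perm_cons perm_catC perm_sym.
have [s' ps /pforest_iso_split[s1 [s2 [? st1 st2]]]] := IHs _ _ su pu; subst s'.
exists (s1 ++ S :: s2).
  by rewrite perm_sym perm_catC /= perm_cons perm_catC perm_sym.
by apply: pforest_iso_cat => //; exact: pforest_iso_cons.
Qed.

Lemma ptree_iso_sym S T : ptree_iso S T -> ptree_iso T S.
Proof.
apply: (@ptree_iso_mind (fun S T => ptree_iso T S)
                        (fun s t => pforest_iso t s)) => {S T}.
- move=> m s s' t; rewrite perm_sym => s's _ ts'.
  have [t' tt' t's] := pforest_iso_perm ts' s's.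
  exact: ptree_iso_node tt' t's.
- exact: pforest_iso_nil.
- by move=> S T s t _ TS _ ts; exact: pforest_iso_cons.
Qed.

Lemma ptree_iso_trans S T U : ptree_iso S T -> ptree_iso T U -> ptree_iso S U.
Proof.
move=> ST TU; move: TU S ST.
apply: (@ptree_iso_mind (fun T U => forall S, ptree_iso S T -> ptree_iso S U)
          (fun t u => forall s, pforest_iso s t -> pforest_iso s u)) => {T U}.
- move=> m t t' u tt' _ IH S ST; inversion ST as [? s s' ? ss' s't]; subst.
  have [s2 s's2 s2t'] := pforest_iso_perm s't tt'.
  exact: ptree_iso_node (perm_trans ss' s's2) (IH _ s2t').
- by [].
- move=> T U t u _ IHT _ IHt s st; inversion st; subst.
  by apply: pforest_iso_cons; [exact: IHT | exact: IHt].
Qed.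

Definition ptree_isob (S T : ptree) : bool := `[< ptree_iso S T >].

Lemma ptree_isob_refl : reflexive ptree_isob.
Proof. by move=> T; apply/asboolP; exact: ptree_iso_refl. Qed.

Lemma ptree_isob_sym : symmetric ptree_isob.
Proof. by move=> S T; apply/asboolP/asboolP; exact: ptree_iso_sym. Qed.

Lemma ptree_isob_trans : transitive ptree_isob.
Proof.
move=> T S U /asboolP ST /asboolP TU; apply/asboolP.
exact: ptree_iso_trans ST TU.
Qed.

Canonical ptree_iso_equiv :=
  EquivRel ptree_isob ptree_isob_refl ptree_isob_sym ptree_isob_trans.

Local Open Scope quotient_scope.

Definition rtree := {eq_quot ptree_isob}.
HB.instance Definition _ := Choice.on rtree.

Fixpoint plabels (T : ptree) : seq nat :=
  let: PNode m s := T in m :: flatten (map plabels s).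

Definition branches (T : rtree) : seq ptree := pchildren (repr T).

(* The trees B_+(T_1, ..., T_k) whose branches T_i are labeled in W. *)
Definition is_barT (W : pred nat) (T : rtree) : bool :=
  (plabel (repr T) == 0%N) &&
  all (fun S => all W (plabels S)) (branches T).

Definition Bplus (s : seq ptree) : rtree := \pi_rtree (PNode 0 s).

(* A vertex is the sequence of the child positions leading to it. *)
Fixpoint vertices (T : ptree) : seq (seq nat) :=
  let: PNode _ s := T in
  [::] :: (fix vertices_of (i : nat) (s : seq ptree) : seq (seq nat) :=
             if s is U :: s' then
               map (cons i) (vertices U) ++ vertices_of i.+1 s'
             else [::]) 0%N s.

(* Join the roots of the trees in g p to each vertex p of T. *)
Fixpoint graft (g : seq nat -> seq ptree) (T : ptree) : ptree :=
  let: PNode m s := T in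
  PNode m (g [::] ++
    (fix graft_in (i : nat) (s : seq ptree) : seq ptree :=
       if s is U :: s' then
         graft (fun p => g (i :: p)) U :: graft_in i.+1 s'
       else [::]) 0%N s).

Section GrossmanLarson.
Variable K : comNzRingType.

Definition gl_mul_tree (T S : rtree) : {malg K[rtree]} :=
  let s := branches T in
  let V := vertices (repr S) in
  \sum_(f : {ffun 'I_(size s) -> 'I_(size V)})
    << \pi_rtree (graft
         (fun p => [seq tnth (in_tuple s) i
                   | i <- enum 'I_(size s) & nth [::] V (f i) == p])
         (repr S)) >>.

Definition gl_mul (x y : {malg K[rtree]}) : {malg K[rtree]} :=
  mlin (fun T => mlin (gl_mul_tree T) y) x.

Definition gl_one : {malg K[rtree]} := << Bplus [::] >>.

Definition gl_coprod_tree (T : rtree) : {malg K[(rtree * rtree)%type]} :=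
  \sum_(I : (size (branches T)).-tuple bool)
    << (Bplus (mask I (branches T)),
        Bplus (mask (map negb I) (branches T))) >>.

Definition gl_coprod : {malg K[rtree]} -> {malg K[(rtree * rtree)%type]} :=
  mlin gl_coprod_tree.

Definition gl_counit : {malg K[rtree]} -> K^o :=
  mlin (fun T => (T == Bplus [::])%:R : K^o).

(* The carrier of the Grossman-Larson algebra, as a submodule of the free module
   on all trees labeled in nat; its product is gl_mul. *)
Definition in_GL (W : pred nat) (x : {malg K[rtree]}) : Prop :=
  forall T, T \in msupp x -> is_barT W T.

Definition gl_conv (f g : {malg K[rtree]} -> {malg K[rtree]})
    (x : {malg K[rtree]}) : {malg K[rtree]} :=
  mlin (fun p : rtree * rtree => gl_mul (f << p.1 >>) (g << p.2 >>))
    (gl_coprod x).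

(* The antipode is the convolution inverse of the identity. *)
Definition gl_antipode (W : pred nat)
    (S : {malg K[rtree]} -> {malg K[rtree]}) : Prop :=
  [/\ forall x, in_GL W x -> in_GL W (S x),
      forall (a : K) x y, in_GL W x -> in_GL W y ->
        S (a *: x + y) = a *: S x + S y &
      forall x, in_GL W x ->
        gl_conv S id x = gl_counit x *: gl_one /\
        gl_conv id S x = gl_counit x *: gl_one].

Section HopfMorphism.
Variables (k : var_kind) (I : finType) (alpha : nat) (W : pred nat).
Let op := operator K k I.

Record GL_hopf_morphism (phi : {malg K[rtree]} -> op) : Prop := {
  hopf_range : forall x, in_GL W x -> diffop alpha (phi x);
  hopf_linear : forall (a : K) x y, in_GL W x -> in_GL W y ->
    phi (a *: x + y) = a *: phi x + phi y;
  hopf_one : phi gl_one = id;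
  hopf_mul : forall x y, in_GL W x -> in_GL W y ->
    phi (gl_mul x y) = phi x \o phi y;
  hopf_coprod : forall x, in_GL W x ->
    coprod_graph alpha (phi x)
      (mlin (fun p : rtree * rtree => tens (phi << p.1 >>) (phi << p.2 >>))
        (gl_coprod x));
  hopf_counit : forall x, in_GL W x ->
    counit_graph alpha (phi x) (gl_counit x);
  hopf_antipode : forall S, gl_antipode W S -> forall x, in_GL W x ->
    antipode_graph alpha (phi x) (phi (S x))
}.

End HopfMorphism.

Section TreeOperators.
Variables (k : var_kind) (I : finType) (H : nat -> I -> pseries K k I).

Fixpoint Ptree (T : ptree) : I -> pseries K k I :=
  let: PNode m s := T in
  fun i => if s is [::] then H m i else Bplus_op (map Ptree s) (H m i).

Definition Dtree (T : rtree) : operator K k I :=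
  if branches T is [::] then id else Bplus_op (map Ptree (branches T)).

Definition AF : {malg K[rtree]} -> operator K k I := mlin Dtree.

End TreeOperators.
End GrossmanLarson.

(* Main.v *)
Require Import Defs.
From mathcomp Require Import all_boot all_algebra.
From mathcomp Require Import finmap generic_quotient.
From mathcomp Require Import boolp functions.
From mathcomp Require Import monalg.

(* Write v.f for [v d/dz] f and B(v_1, ..., v_k) for the operator B_+. On
   K<<z,w>> the derivation sending both z_i and w_i to v_i(w) is the sum of one
   acting on z only and one acting on w only; the first commutes with all the
   [v_j(w) d/dz], the bracket of the second with [v_j(w) d/dz] is
   [(v.v_j)(w) d/dz]. Setting w = z gives
     v o B(v_1, ..., v_k) =
       B(v, v_1, ..., v_k) + sum_j B(v_1, ..., v.v_j, ..., v_k).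
   Read from right to left, this recursion puts B(v_1, ..., v_k) in the algebra
   generated by derivations and yields, by induction on k, its coproduct (the
   sum over the splittings of {1, ..., k}), its counit and its antipode.
   Read from left to right, it shows by induction on trees that a derivation
   applied to P_S is the sum over all ways to attach v to a vertex of S or to
   differentiate a vector field already attached; by induction on k,
   B(v_1, ..., v_k) P_S is then the sum over all ways to attach v_1, ..., v_k to
   vertices of S, which is the Grossman-Larson product. The antipode of the
   Grossman-Larson algebra is determined recursively by the convolution
   identity, which the antipodes of the D_T satisfy as well. *)

Set Implicit Arguments.
Unset Strict Implicit.
Unset Printing Implicit Defensive.

Import GRing.Theory.
Local Open Scope ring_scope.

(** * Monomials *)

Section Monomials.
Variables (k : var_kind) (I : finType).
Implicit Types (w : seq I) (m : monom k I).

(** The kernel of [monom_of_word k]: words spelling the same monomial. *)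
Definition weq (k : var_kind) (w w' : seq I) : bool :=
  match k with
  | Commutative => perm_eq w w'
  | Noncommutative => w == w'
  end.

Lemma monom_of_word_eqE w w' :
  (monom_of_word k w == monom_of_word k w') = weq k w w'.
Proof.
case: k => //=; apply/eqP/idP => [/ffunP E|E].
  by apply/allP => i _ /=; move: (E i); rewrite !ffunE => ->.
by apply/ffunP => i; rewrite !ffunE; apply/permP.
Qed.

Lemma word_of_monomK : cancel (@word_of_monom k I) (@monom_of_word k I).
Proof.
case: k => //= m; apply/ffunP => i; rewrite ffunE count_flatten -map_comp.
rewrite sumnE big_map big_enum (bigD1 i) //= count_nseq /= eqxx mul1n.
rewrite big1 ?addn0 // => j /negbTE ji.
by rewrite count_nseq /= ji mul0n.
Qed.

Lemma monom_of_word_weq w w' :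
  weq k w w' -> monom_of_word k w = monom_of_word k w'.
Proof. by rewrite -monom_of_word_eqE => /eqP. Qed.

Lemma weq_word w : weq k (word_of_monom (monom_of_word k w)) w.
Proof. by rewrite -monom_of_word_eqE word_of_monomK. Qed.

Lemma weq_size w w' : weq k w w' -> size w = size w'.
Proof. by case: k => /= [/perm_size|/eqP->]. Qed.

Lemma weq_cat w1 w2 w1' w2' :
  weq k w1 w1' -> weq k w2 w2' -> weq k (w1 ++ w2) (w1' ++ w2').
Proof. by case: k => /= [|/eqP-> /eqP->//]; exact: perm_cat. Qed.

Lemma mdegree_word w : mdegree (monom_of_word k w) = size w.
Proof. exact/weq_size/weq_word. Qed.

Lemma mmult_word w w' :
  mmult (monom_of_word k w) (monom_of_word k w') = monom_of_word k (w ++ w').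
Proof. by apply/monom_of_word_weq/weq_cat; exact: weq_word. Qed.

Lemma monoms_eqP d m : (m \in monoms_eq k I d) = (mdegree m == d).
Proof.
rewrite mem_undup; apply/mapP/eqP => [[w _ ->]|md].
  by rewrite mdegree_word size_tuple.
exists (tcast md (in_tuple (word_of_monom m))); first by rewrite mem_enum.
by rewrite val_tcast word_of_monomK.
Qed.

Lemma monoms_leP d m : (m \in monoms_le k I d) = (mdegree m <= d)%N.
Proof.
apply/flatten_mapP/idP => [[e]|md].
  by rewrite mem_iota monoms_eqP => /andP[_ ed] /eqP->.
by exists (mdegree m); rewrite ?monoms_eqP // mem_iota.
Qed.

Lemma monoms_eq_uniq d : uniq (monoms_eq k I d).
Proof. exact: undup_uniq. Qed.

Lemma monoms_le_uniq d : uniq (monoms_le k I d).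
Proof.
rewrite /monoms_le; have: uniq (iota 0 d.+1) by exact: iota_uniq.
elim: iota => //= e s IHs /andP[es us]; rewrite cat_uniq monoms_eq_uniq IHs //.
rewrite andbT; apply/hasPn => m /flatten_mapP[e' e's].
rewrite !monoms_eqP => /eqP me; subst e'.
by apply: contra es => /eqP <-.
Qed.

End Monomials.

(** The commutative case is kept as an equation on [k], so that [k] need not be destructed in goals
    whose types depend on it. *)
Variant weq_spec (k : var_kind) (T : eqType) (w w' : seq T) : Prop :=
| WeqCommutative of k = Commutative & perm_eq w w'
| WeqEq of w = w'.

Lemma weqP (k : var_kind) (I : finType) (w w' : seq I) :
  weq k w w' -> weq_spec k w w'.
Proof. by case: k => [|/eqP]; constructor. Qed.

Lemma weq_map (k : var_kind) (I J : finType) (r : I -> J) w w' :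
  weq k w w' -> weq k (map r w) (map r w').
Proof. by case: k => /= [/(perm_map r)|/eqP->]. Qed.

Lemma big_delta (R : nzRingType) (T : choiceType) (s : seq T) (x : T)
    (F : T -> R) : uniq s -> 
  \sum_(a <- s) (a == x)%:R * F a = if x \in s then F x else 0.
Proof.
move=> us; case: ifP => xs.
  rewrite (bigD1_seq x) //= eqxx mul1r big1 ?addr0 // => a /negbTE->.
  by rewrite mul0r.
rewrite big_seq big1 // => a; case: eqP => [->|_ _]; first by rewrite xs.
by rewrite mul0r.
Qed.

(** * Power series and their derivations *)

Section LinearMaps.
Variables (R : pzRingType) (U V : lmodType R).
Implicit Type F : U -> V.

Lemma linP0 F : linear F -> F 0 = 0.
Proof. by move=> lF; have := lF (-1) 0 0; rewrite scaler0 addr0 scaleN1r addNr. Qed.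

Lemma linPD F : linear F -> {morph F : u v / u + v}.
Proof. by move=> lF u v; have := lF 1 u v; rewrite !scale1r. Qed.

Lemma linPZ F : linear F -> forall a, {morph F : u / a *: u}.
Proof. by move=> lF a u; have := lF a u 0; rewrite linP0 // !addr0. Qed.

Lemma linPN F : linear F -> {morph F : u / - u}.
Proof. by move=> lF u; rewrite -!scaleN1r linPZ. Qed.

Lemma linP_sum F : linear F -> forall (J : Type) (s : seq J) (P : pred J) E,
  F (\sum_(j <- s | P j) E j) = \sum_(j <- s | P j) F (E j).
Proof. by move=> lF J s P E; apply: big_morph; [exact: linPD | exact: linP0]. Qed.

End LinearMaps.

Section Series.
Variables (K : comNzRingType) (k : var_kind).
Local Notation S I := (pseries K k I).
Local Notation mon w := (@ps_monom K k _ w).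

Section Basics.
Variable I : finType.
Implicit Types (f g h : S I) (w : seq I).

Lemma psD f g m : (f + g) m = (f m : K) + g m. Proof. by []. Qed.

Lemma psZ (a : K) f m : (a *: f) m = a * (f m : K). Proof. by []. Qed.

Lemma ps_sum (J : Type) (s : seq J) (P : pred J) (F : J -> S I) m :
  (\sum_(j <- s | P j) F j) m = \sum_(j <- s | P j) (F j m : K).
Proof. by elim/big_rec2: _ => // j y1 y2 _ <-. Qed.

Lemma ps_monom_weq w w' : weq k w w' -> mon w = mon w'.
Proof. by move=> ww'; rewrite /ps_monom (monom_of_word_weq ww'). Qed.

Lemma ord_ge_le d e f : (e <= d)%N -> ord_ge d f -> ord_ge e f.
Proof. by move=> ed df m me; apply: df; exact: leq_trans ed. Qed.

Lemma ord_geD d f g : ord_ge d f -> ord_ge d g -> ord_ge d (f + g).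
Proof. by move=> df dg m md; rewrite psD df ?dg ?addr0. Qed.

Lemma ord_geZ d a f : ord_ge d f -> ord_ge d (a *: f).
Proof. by move=> df m md; rewrite psZ df ?mulr0. Qed.

Lemma ord_geN d f : ord_ge d f -> ord_ge d (- f).
Proof. by rewrite -scaleN1r; exact: ord_geZ. Qed.

Lemma ord_ge_monom w : ord_ge (size w) (mon w).
Proof.
move=> m; rewrite /ps_monom; case: eqP => // ->.
by rewrite mdegree_word ltnn.
Qed.

(** Every series is a finite combination of monomials up to a tail of high order. *)
Lemma ps_trunc d f : exists g,
  ord_ge d g /\
  f = \sum_(a <- monoms_le k I d) f a *: mon (word_of_monom a) + g.
Proof.
exists (f - \sum_(a <- monoms_le k I d) f a *: mon (word_of_monom a)).
split; last by rewrite addrC subrK.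
move=> m md; rewrite psD -[(- _) m]/(- (_ m)) ps_sum.
under eq_bigr do rewrite psZ mulrC /ps_monom word_of_monomK eq_sym.
by rewrite big_delta ?monoms_le_uniq // monoms_leP ltnW // subrr.
Qed.

End Basics.

(* The shift c bounds the degrees of the coefficients of f on which a given
   coefficient of F f depends, so F is determined by its values on monomials. *)
Definition cont (I J : finType) (F : S I -> S J) : Prop :=
  linear F /\ exists c, forall d f, ord_ge (d + c) f -> ord_ge d (F f).

(** A fixed coefficient of [F f] does not see the tail of [f], so [f] may be replaced by a finite
    sum of monomials. *)
Lemma cont_ext (I J : finType) (F G : S I -> S J) : cont F -> cont G ->
  (forall w, F (mon w) = G (mon w)) -> F =1 G.
Proof.
move=> [lF [c cF]] [lG [c' cG]] FG f; apply/funext => m.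
(* The tail must have order above [mdegree m] after the shifts of both [F] and [G]; hence the
   maximum. *)
have [g [dg ->]] := ps_trunc ((mdegree m).+1 + maxn c c') f.
rewrite (linPD lF) (linPD lG) (linP_sum lF) (linP_sum lG) !psD.
rewrite (cF (mdegree m).+1) // ?(cG (mdegree m).+1) //; last first.
- by apply: ord_ge_le dg; rewrite leq_add2l leq_maxl.
- by apply: ord_ge_le dg; rewrite leq_add2l leq_maxr.
congr (_ + _); congr ((_ : S J) m); apply: eq_bigr => a _.
by rewrite (linPZ lF) (linPZ lG) FG.
Qed.

Lemma cont_id (I : finType) : cont (@id (S I)).
Proof. by split=> //; exists 0%N => d f; rewrite addn0. Qed.

Lemma cont_comp (I J L : finType) (F : S J -> S L) (G : S I -> S J) :
  cont F -> cont G -> cont (F \o G).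
Proof.
move=> [lF [c cF]] [lG [c' cG]]; split=> [a f g|] /=; first by rewrite lG lF.
by exists (c + c')%N => d f; rewrite addnA => /cG/cF.
Qed.

Lemma cont_lin (I J : finType) a (F G : S I -> S J) :
  cont F -> cont G -> cont (fun f => a *: F f + G f).
Proof.
move=> [lF [c cF]] [lG [c' cG]]; split=> [b f g|] /=.
  rewrite lF lG !scalerDr !scalerA [a * b]mulrC -!addrA; congr (_ + _).
  by rewrite addrCA.
exists (c + c')%N => d f df; apply: ord_geD; first apply: ord_geZ.
  by apply: cF; apply: ord_ge_le df; rewrite leq_add2l leq_addr.
by apply: cG; apply: ord_ge_le df; rewrite leq_add2l leq_addl.
Qed.

Lemma cont_add (I J : finType) (F G : S I -> S J) :
  cont F -> cont G -> cont (fun f => F f + G f).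
Proof.
move=> cF cG; have := cont_lin 1 cF cG; congr cont.
by apply/funext => f; rewrite scale1r.
Qed.

Lemma cont_sub (I J : finType) (F G : S I -> S J) :
  cont F -> cont G -> cont (fun f => F f - G f).
Proof.
move=> cF cG; have := cont_lin (-1) cG cF; congr cont.
by apply/funext => f; rewrite scaleN1r addrC.
Qed.

(** * The product of series and its derivations *)

Section Product.
Variable I : finType.
Implicit Types (f g h : S I) (w : seq I).

Lemma ps_mulDl g : linear (fun f : S I => ps_mul f g).
Proof.
move=> a f f'; apply/funext => m; rewrite psD psZ /ps_mul mulr_sumr -big_split.
apply: eq_bigr => b _ /=; rewrite mulr_sumr -big_split; apply: eq_bigr => c _ /=.
by rewrite psD psZ mulrDl mulrA.
Qed.

Lemma ps_mulDr f : linear (ps_mul f).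
Proof.
move=> a g g'; apply/funext => m; rewrite psD psZ /ps_mul mulr_sumr -big_split.
apply: eq_bigr => b _ /=; rewrite mulr_sumr -big_split; apply: eq_bigr => c _ /=.
by rewrite psD psZ mulrDr mulrCA.
Qed.

Lemma mdegree_mmult (a b : monom k I) :
  mdegree (mmult a b) = (mdegree a + mdegree b)%N.
Proof. by rewrite mdegree_word size_cat. Qed.

Lemma ord_geM d e f g : ord_ge d f -> ord_ge e g -> ord_ge (d + e) (ps_mul f g).
Proof.
move=> df eg m md; rewrite /ps_mul big1 // => a _; rewrite big1 // => b /eqP mE.
move: md; rewrite -mE mdegree_mmult => md.
have [da|da] := ltnP (mdegree a) d; first by rewrite df // mul0r.
rewrite eg ?mulr0 // ltnNge; apply: contraTN md => eb.
by rewrite -leqNgt leq_add.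
Qed.

Lemma cont_mull g : cont (fun f : S I => ps_mul f g).
Proof.
split; first exact: ps_mulDl.
exists 0%N => d f df; have := ord_geM (e := 0) (g := g) df; rewrite !addn0; exact.
Qed.

Lemma cont_mulr f : cont (ps_mul f).
Proof.
split; first exact: ps_mulDr.
exists 0%N => d g dg; rewrite -[d]add0n; apply: (ord_geM (d := 0%N)) => //.
by move: dg; rewrite addn0.
Qed.

Lemma ps_mul_monom w w' : ps_mul (mon w) (mon w') = mon (w ++ w').
Proof.
apply/funext => m; rewrite /ps_mul /ps_monom.
(* The two Kronecker deltas are summed one after the other; [c a] is what the inner sum over [b]
   leaves. *)
pose c a := (monom_of_word k w' \in monoms_le k I (mdegree m)) &&
  (mmult a (monom_of_word k w') == m).
transitivity (\sum_(a <- monoms_le k I (mdegree m))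
    (a == monom_of_word k w)%:R * (c a)%:R : K).
  apply: eq_bigr => a _; rewrite big_mkcond /= /c.
  under eq_bigr => b _.
    rewrite (_ : (if _ then _ else _) = (b == monom_of_word k w')%:R *
      ((a == monom_of_word k w)%:R * (mmult a b == m)%:R)); last first.
      by case: (mmult a b == m); rewrite ?mulr1 ?mulr0 // mulrC.
    over.
  by rewrite big_delta ?monoms_le_uniq //; case: ifP; rewrite ?mulr0.
rewrite big_delta ?monoms_le_uniq // /c !monoms_leP !mdegree_word mmult_word.
case: (eqVneq m) => [->|]; last first.
  by move=> _; rewrite andbF; case: ifP.
by rewrite mdegree_word size_cat leq_addr leq_addl.
Qed.

(** Both sides are continuous in each argument, so [cont_ext], used once per argument, reduces the
    claim to concatenation of words. The same scheme proves [ps_mulC], [vderM] and [renameM]. *)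
Lemma ps_mulA f g h : ps_mul f (ps_mul g h) = ps_mul (ps_mul f g) h.
Proof.
apply: (cont_ext (F := fun f => ps_mul f _)
  (G := fun f => ps_mul (ps_mul f g) h)) => {f} [||u].
- exact: cont_mull.
- by apply: (cont_comp (cont_mull h)); exact: cont_mull.
apply: (cont_ext (F := fun g => ps_mul _ (ps_mul g h))
  (G := fun g => ps_mul (ps_mul _ g) h)) => {g} [||v].
- by apply: (cont_comp (cont_mulr _)); exact: cont_mull.
- by apply: (cont_comp (cont_mull h)); exact: cont_mulr.
apply: (cont_ext (F := fun h => ps_mul _ (ps_mul _ h))) => {h} [||w].
- by apply: (cont_comp (cont_mulr _)); exact: cont_mulr.
- exact: cont_mulr.
by rewrite !ps_mul_monom catA.
Qed.

Lemma ps_mul1 f : ps_mul (@ps_one K k I) f = f.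
Proof.
apply: (cont_ext (F := ps_mul _) (G := id)) => [||w]; first exact: cont_mulr.
  exact: cont_id.
by rewrite ps_mul_monom.
Qed.

Lemma ps_mulf1 f : ps_mul f (@ps_one K k I) = f.
Proof.
apply: (cont_ext (F := fun f => ps_mul f _) (G := id)) => [||w].
- exact: cont_mull.
- exact: cont_id.
by rewrite ps_mul_monom cats0.
Qed.

Lemma ps_mulC f g : k = Commutative -> ps_mul f g = ps_mul g f.
Proof.
move=> kC; apply: (cont_ext (F := fun f => ps_mul f _)) => {f} [||u].
- exact: cont_mull.
- exact: cont_mulr.
apply: (cont_ext (F := ps_mul _) (G := fun g => ps_mul g _)) => {g} [||v].
- exact: cont_mulr.
- exact: cont_mull.
rewrite !ps_mul_monom; apply: ps_monom_weq.
by rewrite /weq kC perm_catC.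
Qed.

Lemma vder_word_cat (u : I -> S I) w w' : vder_word u (w ++ w') =
  ps_mul (vder_word u w) (mon w') + ps_mul (mon w) (vder_word u w').
Proof.
elim: w => [|i w IHw] /=.
  by rewrite (linP0 (ps_mulDl _)) add0r ps_mul1.
rewrite IHw (linPD (ps_mulDr _)) (linPD (ps_mulDl _)) -!ps_mulA.
rewrite ps_mul_monom addrA [ps_mul (ps_var K i) (ps_mul (mon w) _)]ps_mulA.
by rewrite ps_mul_monom.
Qed.

(** Independence from the word chosen for a monomial. In the commutative case the first letter of
    [w] is located in [w'] and moved to the front by [ps_mulC]. *)
Lemma vder_word_weq (u : I -> S I) w w' : weq k w w' -> vder_word u w = vder_word u w'.
Proof.
case/weqP=> [kE|->//].
elim: w w' => [|i w IHw] w'; first by rewrite perm_sym => /perm_nilP->.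
move=> ww'; have iw' : i \in w' by rewrite -(perm_mem ww') mem_head.
case/splitPr: iw' ww' => w1 w2 ww'.
have pw : perm_eq w (w1 ++ w2).
  by move: ww'; rewrite perm_sym perm_catC /= perm_cons perm_catC perm_sym.
have weqC (v v' : seq I) : perm_eq v v' -> mon v = mon v'.
  by move=> vv'; apply: ps_monom_weq; rewrite /weq kE.
rewrite /= (IHw _ pw) !vder_word_cat /= !(linPD (ps_mulDr _)) !addrA.
rewrite (weqC _ _ pw) -!ps_mul_monom !ps_mulA.
rewrite (_ : mon (i :: w2) = ps_mul (ps_var K i) (mon w2)); last first.
  by rewrite ps_mul_monom.
rewrite ps_mulA [ps_mul (u i) _]ps_mulC // [ps_mul (ps_var K i) (mon w1)]ps_mulC //.
rewrite [ps_mul (ps_var K i) (vder_word u w1)]ps_mulC //.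
by congr (_ + _); rewrite addrC.
Qed.

(** Each summand trades one letter, of degree 1, for a series of order at least [d]. *)
Lemma ord_ge_vder_word d (u : I -> S I) w :
  (forall i, ord_ge d (u i)) -> ord_ge (size w + d - 1) (vder_word u w).
Proof.
move=> du; elim: w => [|i w IHw] //=.
rewrite addSn subn1 /=; apply: ord_geD.
  by rewrite addnC; apply: ord_geM => //; exact: ord_ge_monom.
have := ord_geM (ord_ge_monom (w := [:: i])) IHw.
by apply: ord_ge_le; rewrite /= add1n subn1 leqSpred.
Qed.

Lemma vder_linear (u : I -> S I) : linear (vder u).
Proof.
move=> a f g; apply/funext => m; rewrite psD psZ /vder mulr_sumr -big_split.
by apply: eq_bigr => b _ /=; rewrite psD psZ mulrDl mulrA.
Qed.

Lemma ord_ge_vder d e (u : I -> S I) f : (forall i, ord_ge e (u i)) ->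
  ord_ge d f -> ord_ge (d + e - 1) (vder u f).
Proof.
move=> eu df m md; rewrite /vder big1 // => a _.
have [ad|da] := ltnP (mdegree a) d; first by rewrite df ?mul0r.
rewrite (ord_ge_vder_word eu) ?mulr0 //; apply: leq_trans md _.
by rewrite leq_sub2r // leq_add2r.
Qed.

Lemma cont_vder (u : I -> S I) : cont (vder u).
Proof.
split; first exact: vder_linear.
(* A derivation lowers the order by at most one, even when the [u i] have constant terms. *)
exists 1%N => d f df; have := ord_ge_vder (e := 0) (u := u) (fun _ _ => _) df.
by rewrite addn0 addn1 subn1; apply.
Qed.

Lemma vder_monom (u : I -> S I) w : vder u (mon w) = vder_word u w.
Proof.
apply/funext => m; rewrite /vder /ps_monom.
rewrite (big_delta _ (fun a => vder_word u (word_of_monom a) m)).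
  rewrite monoms_leP mdegree_word; case: leqP => [_|mw].
    by rewrite (vder_word_weq u (weq_word k w)).
  (* Here [w] is too long to occur in the truncated sum, but then its derivative has order above
     [mdegree m]. *)
  rewrite (ord_ge_vder_word (d := 0%N)) // addn0 subn1.
  by rewrite ltn_predRL.
exact: monoms_le_uniq.
Qed.

Lemma vderM (u : I -> S I) f g :
  vder u (ps_mul f g) = ps_mul (vder u f) g + ps_mul f (vder u g).
Proof.
apply: (cont_ext (F := fun f => vder u (ps_mul f g))
  (G := fun f => ps_mul (vder u f) g + ps_mul f (vder u g))) => {f} [||v].
- by apply: (cont_comp (cont_vder u)); exact: cont_mull.
- apply: cont_add; last exact: cont_mull.
  by apply: (cont_comp (cont_mull g)); exact: cont_vder.
apply: (cont_ext (F := fun g => vder u (ps_mul _ g))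
  (G := fun g => ps_mul (vder u _) g + ps_mul _ (vder u g))) => {g} [||w].
- by apply: (cont_comp (cont_vder u)); exact: cont_mulr.
- apply: cont_add; first exact: cont_mulr.
  by apply: (cont_comp (cont_mulr _)); exact: cont_vder.
by rewrite ps_mul_monom !vder_monom vder_word_cat.
Qed.

Lemma vder_var (u : I -> S I) i : vder u (ps_var K i) = u i.
Proof. by rewrite vder_monom /= (linP0 (ps_mulDr _)) addr0 ps_mulf1. Qed.

Lemma vder_derivation (u : I -> S I) : derivation (vder u).
Proof. by split; [exact: vder_linear | exact: vderM]. Qed.

Lemma vder_derivation_ge d (u : I -> S I) :
  (forall i, ord_ge d (u i)) -> derivation_ge d (vder u).
Proof.
by move=> du; split=> [|e f]; [exact: vder_derivation | exact: ord_ge_vder].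
Qed.

End Product.

(** * Renaming of variables *)

Section Rename.
Variables (I J : finType) (r : I -> J).

Lemma cont_rename : cont (@ps_rename K k I J r).
Proof.
split=> [a f g|].
  apply/funext => m; rewrite psD psZ /ps_rename mulr_sumr -big_split.
  by apply: eq_bigr.
exists 0%N => d f; rewrite addn0 => df m md; rewrite /ps_rename big_seq_cond.
by rewrite big1 // => a; rewrite monoms_eqP => /andP[/eqP ma _]; rewrite df ?ma.
Qed.

Lemma rename_monom w : ps_rename r (mon w) = mon (map r w).
Proof.
apply/funext => m; rewrite /ps_rename /ps_monom big_mkcond /=.
pose c (a : monom k I) := monom_of_word k (map r (word_of_monom a)) == m.
transitivity (\sum_(a <- monoms_eq k I (mdegree m))
    (a == monom_of_word k w)%:R * (c a)%:R : K).
  by apply: eq_bigr => a _; rewrite /c; case: eqP; rewrite ?mulr1 ?mulr0.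
rewrite big_delta ?monoms_eq_uniq // /c monoms_eqP mdegree_word.
rewrite (monom_of_word_weq (weq_map r (weq_word k w))) eq_sym.
case: (eqVneq m) => [->|]; last by case: ifP.
by rewrite mdegree_word size_map eqxx.
Qed.

Lemma rename_var i : ps_rename r (ps_var K i) = @ps_var K k J (r i).
Proof. exact: rename_monom. Qed.

Lemma renameM (f g : S I) :
  ps_rename r (ps_mul f g) = ps_mul (ps_rename r f) (ps_rename r g).
Proof.
apply: (cont_ext (F := fun f => ps_rename r (ps_mul f g))
  (G := fun f => ps_mul (ps_rename r f) (ps_rename r g))) => {f} [||v].
- by apply: (cont_comp cont_rename); exact: cont_mull.
- by apply: (cont_comp (cont_mull _)); exact: cont_rename.
apply: (cont_ext (F := fun g => ps_rename r (ps_mul _ g))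
  (G := fun g => ps_mul (ps_rename r _) (ps_rename r g))) => {g} [||w].
- by apply: (cont_comp cont_rename); exact: cont_mulr.
- by apply: (cont_comp (cont_mulr _)); exact: cont_rename.
by rewrite ps_mul_monom !rename_monom map_cat ps_mul_monom.
Qed.

End Rename.

Lemma rename_comp (I J L : finType) (r : I -> J) (q : J -> L) (f : S I) :
  ps_rename q (ps_rename r f) = ps_rename (q \o r) f.
Proof.
apply: (cont_ext (F := ps_rename q \o ps_rename r)) => {f} [||w].
- by apply: cont_comp; exact: cont_rename.
- exact: cont_rename.
by rewrite /= !rename_monom map_comp.
Qed.

Lemma rename_id (I : finType) (f : S I) : ps_rename id f = f.
Proof.
apply: (cont_ext (G := id)) f => [||w]; [exact: cont_rename | exact: cont_id |].
by rewrite rename_monom map_id.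
Qed.

(** Continuous derivations over the algebra morphism [ps_rename r]. They allow comparing composites
    of derivations with renamings, which are not derivations of a single algebra. *)
Definition der_along (I J : finType) (r : I -> J) (F : S I -> S J) : Prop :=
  cont F /\ forall f g, F (ps_mul f g) =
    ps_mul (F f) (ps_rename r g) + ps_mul (ps_rename r f) (F g).

Lemma der_along_one (I J : finType) (r : I -> J) (F : S I -> S J) :
  der_along r F -> F (@ps_one K k I) = 0.
Proof.
move=> [_ /(_ (@ps_one K k I) (@ps_one K k I))].
rewrite ps_mul1 rename_monom ps_mul1 ps_mulf1 => /eqP.
by rewrite -subr_eq subrr eq_sym => /eqP.
Qed.

(** The Leibniz rule propagates agreement from variables to words, and continuity from words to all
    series. *)
Lemma der_along_ext (I J : finType) (r : I -> J) (F G : S I -> S J) :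
  der_along r F -> der_along r G ->
  (forall i, F (ps_var K i) = G (ps_var K i)) -> F =1 G.
Proof.
move=> dF dG FG; apply: (cont_ext dF.1 dG.1); elim=> [|i w IHw].
  by rewrite (der_along_one dF) (der_along_one dG).
have -> : mon (i :: w) = ps_mul (ps_var K i) (mon w) by rewrite ps_mul_monom.
by rewrite dF.2 dG.2 FG IHw.
Qed.

Lemma der_vder (I : finType) (u : I -> S I) : der_along id (vder u).
Proof. by split=> [|f g]; [exact: cont_vder | rewrite vderM !rename_id]. Qed.

Lemma der_rename_comp (I J L : finType) (r : I -> J) (q : J -> L)
    (F : S I -> S J) :
  der_along r F -> der_along (q \o r) (fun f => ps_rename q (F f)).
Proof.
move=> [cF dF]; split=> [|f g].
  by apply: (cont_comp _ cF); exact: cont_rename.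
by rewrite dF (linPD (cont_rename q).1) !renameM !rename_comp.
Qed.

Lemma der_comp_rename (I J L : finType) (r : I -> J) (q : J -> L)
    (F : S J -> S L) :
  der_along q F -> der_along (q \o r) (fun f => F (ps_rename r f)).
Proof.
move=> [cF dF]; split=> [|f g].
  by apply: (cont_comp cF); exact: cont_rename.
by rewrite renameM dF !rename_comp.
Qed.

Lemma der_add (I J : finType) (r : I -> J) (F G : S I -> S J) :
  der_along r F -> der_along r G -> der_along r (fun f => F f + G f).
Proof.
move=> [cF dF] [cG dG]; split=> [|f g]; first exact: cont_add.
by rewrite dF dG (linPD (ps_mulDl _)) (linPD (ps_mulDr _)) addrACA.
Qed.

(** The mixed products [F f] times [G g] and [G f] times [F g] occur in both composites and
    cancel. *)
Lemma der_commutator (I : finType) (F G : S I -> S I) :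
  der_along id F -> der_along id G ->
  der_along id (fun f => F (G f) - G (F f)).
Proof.
move=> [cF dF] [cG dG]; split=> [|f g].
  by apply: cont_sub; exact: cont_comp.
rewrite dF dG (linPD cF.1) (linPD cG.1) !dF !dG !rename_id.
rewrite (linPD (ps_mulDl _)) (linPD (ps_mulDr _)).
rewrite (linPN (ps_mulDl _)) (linPN (ps_mulDr _)).
set a := ps_mul (F (G f)) g; set b := ps_mul (G f) (F g).
set c := ps_mul (F f) (G g); set d := ps_mul f (F (G g)).
rewrite [a + b + _]addrACA opprD [LHS]addrACA; congr (_ + _).
  by rewrite opprD addrACA subrr addr0.
by rewrite opprD addrACA subrr add0r.
Qed.

Lemma vder_rename (I J : finType) (r : I -> J) (u : I -> S I) (v : J -> S J) f :
  (forall i, v (r i) = ps_rename r (u i)) ->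
  vder v (ps_rename r f) = ps_rename r (vder u f).
Proof.
move=> vu; apply: (der_along_ext (r := r) (F := fun f => vder v (ps_rename r f))
  (G := fun f => ps_rename r (vder u f))).
- exact: (der_comp_rename r (der_vder v)).
- exact: (der_rename_comp r (der_vder u)).
by move=> i; rewrite rename_var !vder_var.
Qed.

End Series.

(** * The operators B_+ *)

Section Replace.
Variables (V : Type) (act : V -> V -> V).

(** The sum over j in the recursion for B_+. The target is arbitrary, since operators, tensors,
    scalars and series all occur as values. *)
Fixpoint repl_sum (M : zmodType) (Phi : seq V -> M) (v : V) (vs : seq V) : M :=
  if vs is u :: us then
    Phi (act v u :: us) + repl_sum (fun l => Phi (u :: l)) v us
  else 0.

Lemma repl_sum_ext (M : zmodType) (Phi Psi : seq V -> M) v vs :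
  (forall l, size l = size vs -> Phi l = Psi l) ->
  repl_sum Phi v vs = repl_sum Psi v vs.
Proof.
elim: vs Phi Psi => //= u us IHus Phi Psi E; congr (_ + _); first exact: E.
by apply: IHus => l ls; apply: E; rewrite /= ls.
Qed.

Lemma repl_sumD (M : zmodType) (Phi Psi : seq V -> M) v vs :
  repl_sum (fun l => Phi l + Psi l) v vs = repl_sum Phi v vs + repl_sum Psi v vs.
Proof.
elim: vs Phi Psi => [|u us IHus] Phi Psi /=; first by rewrite addr0.
by rewrite IHus addrACA.
Qed.

Lemma repl_sum0 (M : zmodType) v vs : repl_sum (fun=> 0 : M) v vs = 0.
Proof. by elim: vs => //= u us ->; rewrite addr0. Qed.

Lemma repl_sum_bigsum (J : Type) (r : seq J) (M : zmodType)
    (Phi : J -> seq V -> M) v vs :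
  repl_sum (fun l => \sum_(j <- r) Phi j l) v vs =
  \sum_(j <- r) repl_sum (Phi j) v vs.
Proof.
elim: vs Phi => [|u us IHus] Phi /=; first by rewrite big1.
by rewrite IHus big_split.
Qed.

Lemma repl_sum_cat (M : zmodType) (Phi : seq V -> M) v s1 s2 :
  repl_sum Phi v (s1 ++ s2) =
  repl_sum (fun l => Phi (l ++ s2)) v s1 + repl_sum (fun l => Phi (s1 ++ l)) v s2.
Proof.
elim: s1 Phi => [|u s1 IHs] Phi /=; first by rewrite add0r.
by rewrite IHs addrA.
Qed.

(** [Phi] is only tested on lists as long as [vs], so that an induction on the length applies to
    every summand; [repl_sum_rel] is the version for two sums. *)
Lemma repl_sum_closed (P : V -> Prop) (M : zmodType) (Q : M -> Prop) Phi v vs :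
  Q 0 -> (forall x y, Q x -> Q y -> Q (x + y)) ->
  (forall u, P u -> P (act v u)) ->
  all (fun u => `[< P u >]) vs ->
  (forall l, size l = size vs -> all (fun u => `[< P u >]) l -> Q (Phi l)) ->
  Q (repl_sum Phi v vs).
Proof.
move=> Q0 QD PA; elim: vs Phi => //= u us IHus Phi /andP[/asboolP Pu Pus] QPhi.
apply: QD; first by apply: QPhi => //=; rewrite Pus andbT; apply/asboolP/PA.
by apply: IHus => // l ls Pl; apply: QPhi; rewrite /= ?ls // Pl andbT; apply/asboolP.
Qed.

Lemma repl_sum_rel (P : V -> Prop) (M N : zmodType) (Q : M -> N -> Prop)
    Phi Psi v vs :
  Q 0 0 -> (forall x y x' y', Q x x' -> Q y y' -> Q (x + y) (x' + y')) ->
  (forall u, P u -> P (act v u)) ->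
  all (fun u => `[< P u >]) vs ->
  (forall l, size l = size vs -> all (fun u => `[< P u >]) l ->
    Q (Phi l) (Psi l)) ->
  Q (repl_sum Phi v vs) (repl_sum Psi v vs).
Proof.
move=> Q0 QD PA; elim: vs Phi Psi => //= u us IHus Phi Psi /andP[/asboolP Pu Pus] QP.
apply: QD; first by apply: QP => //=; rewrite Pus andbT; apply/asboolP/PA.
by apply: IHus => // l ls Pl; apply: QP; rewrite /= ?ls // Pl andbT; apply/asboolP.
Qed.

Lemma repl_sum_morph (M N : zmodType) (h : M -> N) Phi v vs :
  h 0 = 0 -> {morph h : x y / x + y} ->
  h (repl_sum Phi v vs) = repl_sum (fun l => h (Phi l)) v vs.
Proof. by move=> h0 hD; elim: vs Phi => //= u us IHus Phi; rewrite hD IHus. Qed.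

End Replace.

Section Bplus.
Variables (K : comNzRingType) (k : var_kind).
Local Notation S I := (pseries K k I).

Lemma vder0 (I : finType) (f : S I) : vder (fun=> 0) f = 0.
Proof.
apply/funext => m; rewrite /vder big1 // => a _.
suff ->: vder_word (fun=> 0) (word_of_monom a) = 0 :> S I by rewrite mulr0.
elim: word_of_monom => //= i w ->.
by rewrite (linP0 (ps_mulDl _)) (linP0 (ps_mulDr _)) addr0.
Qed.

Lemma rename0 (I J : finType) (r : I -> J) : ps_rename r (0 : S I) = 0.
Proof. exact: (linP0 (@cont_rename K k I J r).1). Qed.

Lemma renameD (I J : finType) (r : I -> J) :
  {morph (@ps_rename K k I J r) : f g / f + g}.
Proof. exact: (linPD (@cont_rename K k I J r).1). Qed.

Lemma vderr0 (I : finType) (u : I -> S I) : vder u 0 = 0.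
Proof. exact: (linP0 (@cont_vder K k I u).1). Qed.

Lemma vderD (I : finType) (u : I -> S I) : {morph vder u : f g / f + g}.
Proof. exact: (linPD (@cont_vder K k I u).1). Qed.

(** * Derivations in the variables z and w, and the recursion for B_+ *)

Section Fields.
Variable I : finType.
Notation vfield := (I -> S I).
Implicit Types (u v : vfield) (vs us : seq vfield).

Definition vact v u : vfield := fun i => vder v (u i).

(** The counterpart of [vder_w v]: it acts on the w variables and kills the z variables. *)
Definition wder v : S (I + I)%type -> S (I + I)%type :=
  vder (fun x => match x with inl _ => 0 | inr i => ps_rename inr (v i) end).

Definition zw : I + I -> I := fun x => match x with inl i => i | inr i => i end.

Lemma vder_w0 v : vder_w v 0 = 0. Proof. exact: vderr0. Qed.

Lemma wder0 v : wder v 0 = 0. Proof. exact: vderr0. Qed.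

Lemma vder_wD v : {morph @vder_w K k I v : f g / f + g}.
Proof. exact: vderD. Qed.

Lemma vder_wR v f : vder_w v (ps_rename inr f) = 0.
Proof.
rewrite /vder_w (vder_rename (u := fun=> 0)) => [|i]; last by rewrite rename0.
by rewrite vder0 rename0.
Qed.

Lemma wder_L v f : wder v (ps_rename inl f) = 0.
Proof.
rewrite /wder (vder_rename (u := fun=> 0)) => [|i]; last by rewrite rename0.
by rewrite vder0 rename0.
Qed.

Lemma wder_R v f : wder v (ps_rename inr f) = ps_rename inr (vder v f).
Proof. exact: vder_rename. Qed.

(** The commutator is a derivation and vanishes on variables, because [vder_w] produces series in w,
    which [vder_w] kills. *)
Lemma vder_w_comm u v f : vder_w u (vder_w v f) = vder_w v (vder_w u f).
Proof.
apply/eqP; rewrite -subr_eq0; apply/eqP; rewrite -[RHS](vder0 f).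
apply: (der_along_ext (r := id)
  (F := fun f => vder_w u (vder_w v f) - vder_w v (vder_w u f))).
- by apply: der_commutator; exact: der_vder.
- exact: der_vder.
move=> [i|i]; rewrite /vder_w !vder_var -/(vder_w u) -/(vder_w v).
  by rewrite !vder_wR subrr.
by rewrite !vder_w0 subrr.
Qed.

(** The bracket is a derivation too; the only nonzero values to compare are those on z_i, where
    [wder u] differentiates v_i(w). *)
Lemma wder_vder_w u v f :
  wder u (vder_w v f) = vder_w v (wder u f) + vder_w (vact u v) f.
Proof.
apply/eqP; rewrite addrC -subr_eq; apply/eqP.
apply: (der_along_ext (r := id)
  (F := fun f => wder u (vder_w v f) - vder_w v (wder u f))).
- by apply: der_commutator; exact: der_vder.
- exact: der_vder.
move=> [i|i]; rewrite /vder_w /wder !vder_var -/(vder_w v) -/(wder u).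
  by rewrite vder_w0 subr0 wder_R.
by rewrite vder_wR wder0 subrr.
Qed.

(* The derivation sending z_i and w_i to v_i(w) is vder_w v + wder v. *)
Lemma vder_zw v f :
  vder v (ps_rename zw f) = ps_rename zw (vder_w v f) + ps_rename zw (wder v f).
Proof.
apply: (der_along_ext (r := zw) (F := fun f => vder v (ps_rename zw f))
  (G := fun f => ps_rename zw (vder_w v f) + ps_rename zw (wder v f))).
- exact: (der_comp_rename zw (der_vder v)).
- by apply: der_add; exact: (der_rename_comp zw (der_vder _)).
move=> [i|i]; rewrite /vder_w /wder rename_var !vder_var rename_comp.
  by rewrite rename0 addr0 [RHS]rename_id.
by rewrite rename0 add0r [RHS]rename_id.
Qed.

(** Moving [wder v] inwards past each [vder_w u] costs, by [wder_vder_w], one term with [vact v u]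
    in place of [u]. *)
Lemma wder_foldr v vs (f : S (I + I)%type) :
  wder v (foldr (@vder_w K k I) f vs) =
  foldr (@vder_w K k I) (wder v f) vs +
    repl_sum vact (foldr (@vder_w K k I) f) v vs.
Proof.
elim: vs => [|u us IHus] /=; first by rewrite addr0.
rewrite wder_vder_w IHus vder_wD -!addrA; congr (_ + _).
rewrite addrC; congr (_ + _).
rewrite (repl_sum_morph _ (h := vder_w u)) //; first exact: vder_w0.
exact: vderD.
Qed.

Lemma Bplus_nil : Bplus_op [::] = id :> operator K k I.
Proof. by apply/funext => f; rewrite /Bplus_op rename_comp [LHS]rename_id. Qed.

(** [vder_zw] splits the derivation in two; the part acting on w is moved inwards by [wder_foldr]
    and dies on the innermost series, which involves z only. *)
Lemma vder_Bplus v vs : vder v \o Bplus_op vs =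
  Bplus_op (v :: vs) + repl_sum vact (@Bplus_op K k I) v vs :> operator K k I.
Proof.
apply/funext => f; rewrite /= /Bplus_op -/zw vder_zw; congr (_ + _).
rewrite wder_foldr wder_L.
have -> : foldr (@vder_w K k I) 0 vs = 0.
  by elim: vs => //= u us ->; rewrite vder_w0.
rewrite add0r (repl_sum_morph _ (h := ps_rename zw)).
- by rewrite (repl_sum_morph _ (h := fun F : operator K k I => F f)).
- exact: rename0.
- exact: renameD.
Qed.

Lemma Bplus_cons v vs : Bplus_op (v :: vs) =
  vder v \o Bplus_op vs - repl_sum vact (@Bplus_op K k I) v vs :> operator K k I.
Proof. by rewrite vder_Bplus addrK. Qed.

Lemma Bplus_linear vs : linear (Bplus_op vs : S I -> S I).
Proof.
have lf : linear (fun f : S (I + I)%type => foldr (@vder_w K k I) f vs).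
  by elim: vs => //= u us IHus a f g; rewrite IHus; exact: (@cont_vder K k _ _).1.
move=> a f g.
by rewrite /Bplus_op (@cont_rename K k _ _ _).1 lf (@cont_rename K k _ _ _).1.
Qed.

(** The [vder_w v] commute. The permutation acts on indices, which will be trees. *)
Lemma Bplus_perm (T : eqType) (F : T -> vfield) s t : perm_eq s t ->
  Bplus_op (map F s) = Bplus_op (map F t) :> operator K k I.
Proof.
move=> st; apply/funext => f; congr ps_rename.
have E x s1 s2 (g : S (I + I)%type) :
    foldr (@vder_w K k I) g (map F (s1 ++ x :: s2)) =
    foldr (@vder_w K k I) g (map F (x :: s1 ++ s2)).
  by elim: s1 => //= y s1 ->; rewrite vder_w_comm.
elim: s t st => [|x s IHs] t; first by rewrite perm_sym => /perm_nilP->.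
move=> st; have xt : x \in t by rewrite -(perm_mem st) mem_head.
case/splitPr: xt st => t1 t2; rewrite perm_sym perm_catC /= perm_cons perm_catC.
by rewrite perm_sym E /= => /IHs->.
Qed.

Definition vfield_ge alpha u : Prop := forall i, ord_ge alpha (u i).

Definition vfields_ge alpha vs : bool := all (fun u => `[< vfield_ge alpha u >]) vs.

(** * Orders, and membership in the algebra generated by derivations *)

Section Order.
Variables (alpha : nat) (alpha_gt0 : (0 < alpha)%N).
Local Notation good := (vfield_ge alpha).
Local Notation allgood := (vfields_ge alpha).

Lemma ord_ge_vder_same d u f : good u -> ord_ge d f -> ord_ge d (vder u f).
Proof.
move=> gu df; apply: (@ord_ge_le _ _ _ (d + alpha - 1)) (ord_ge_vder gu df).
by rewrite -addnBA // leq_addr.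
Qed.

Lemma vact_good u v : good u -> good v -> good (vact u v).
Proof. by move=> gu gv i; exact: ord_ge_vder_same. Qed.

Lemma ord_ge_Bplus d vs f : allgood vs -> ord_ge d f -> ord_ge d (Bplus_op vs f).
Proof.
(* The induction is on a bound for the length: the recursion [Bplus_cons] calls for modified lists,
   which are shorter but are not tails of [vs]. The later proofs about [Bplus_op] proceed
   likewise. *)
move=> gvs df; move: {2}(size vs) (leqnn (size vs)) => n.
elim: n vs gvs => [|n IHn] [|v vs] //; rewrite ?Bplus_nil //=.
move=> /andP[/asboolP gv gvs] vn.
rewrite Bplus_cons; apply: ord_geD; first by apply: ord_ge_vder_same => //; exact: IHn.
apply: ord_geN; rewrite (repl_sum_morph _ (h := fun F : operator K k I => F f)) //.
apply: (repl_sum_closed (P := good) (Q := @ord_ge K k I d)) => //.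
- by move=> x y; exact: ord_geD.
- by move=> u; exact: vact_good.
- by move=> l ls gl; apply: IHn; rewrite ?ls.
Qed.

Lemma derivation_ge0 : derivation_ge alpha (0 : operator K k I).
Proof.
split=> [|d f _] //; split=> [a f g|f g]; first by rewrite scaler0 addr0.
by rewrite (linP0 (ps_mulDl _)) (linP0 (ps_mulDr _)) addr0.
Qed.

Lemma diffop0 : diffop alpha (0 : operator K k I).
Proof. exact/diffop_der/derivation_ge0. Qed.

Lemma diffopD (x y : operator K k I) :
  diffop alpha x -> diffop alpha y -> diffop alpha (x + y).
Proof. by move=> dx dy; rewrite -[x]scale1r; exact: diffop_lin. Qed.

Lemma diffopN (x : operator K k I) : diffop alpha x -> diffop alpha (- x).
Proof.
by move=> dx; rewrite -scaleN1r -[_ *: _]addr0; apply: diffop_lin => //; exact: diffop0.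
Qed.

Lemma diffop_vder u : good u -> diffop alpha (vder u : operator K k I).
Proof. by move=> gu; apply: diffop_der; exact: vder_derivation_ge. Qed.

Lemma diffop_Bplus vs : allgood vs -> diffop alpha (Bplus_op vs : operator K k I).
Proof.
move=> gvs; move: {2}(size vs) (leqnn (size vs)) => n.
elim: n vs gvs => [|n IHn] [|v vs] //; rewrite ?Bplus_nil //=;
  try by move=> *; exact: diffop_one.
move=> /andP[/asboolP gv gvs] vn; rewrite Bplus_cons; apply: diffopD.
  by apply: diffop_mul; [exact: diffop_vder | exact: IHn].
apply: diffopN; apply: (repl_sum_closed (P := good)) => //.
- exact: diffop0.
- exact: diffopD.
- by move=> u; exact: vact_good.
- by move=> l ls gl; apply: IHn; rewrite ?ls.
Qed.

End Order.
End Fields.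
End Bplus.

(** * Hopf structure of the operators B_+ *)

Section FreeModule.
Variables (K : comNzRingType) (T : choiceType).
Implicit Types x y : {malg K[T]}.

Lemma mlinEw (V : lmodType K) (f : T -> V) x (E : {fset T}) :
  (msupp x `<=` E)%fset -> mlin f x = \sum_(t <- E) x@_t *: f t.
Proof.
move=> xE; apply: big_fset_incl => // t _ tx.
by rewrite mcoeff_outdom // scale0r.
Qed.

Lemma mlin_linear (V : lmodType K) (f : T -> V) : linear (mlin f).
Proof.
move=> a x y; set E := (msupp x `|` msupp y)%fset.
rewrite (@mlinEw _ f x E) ?fsubsetUl // (@mlinEw _ f y E) ?fsubsetUr //.
rewrite (@mlinEw _ f _ E); last first.
  apply: fsubset_trans (msuppD_le _ _) _; apply: fsetSU; exact: msuppZ_le.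
rewrite scaler_sumr -big_split; apply: eq_bigr => t _ /=.
by rewrite mcoeffD mcoeffZ scalerDl scalerA.
Qed.

Lemma mlin_basis (V : lmodType K) (f : T -> V) t : mlin f << t >> = f t.
Proof. by rewrite (mlinEw f msuppU_le) big_seq_fset1 mcoeffUU scale1r. Qed.

Lemma mlin0 (V : lmodType K) (f : T -> V) : mlin f 0 = 0.
Proof. exact: (linP0 (mlin_linear f)). Qed.

Lemma mlinD (V : lmodType K) (f : T -> V) : {morph mlin f : x y / x + y}.
Proof. exact: (linPD (mlin_linear f)). Qed.

Lemma mlinN (V : lmodType K) (f : T -> V) : {morph mlin f : x / - x}.
Proof. exact: (linPN (mlin_linear f)). Qed.

Lemma mlin_id x : mlin (fun t => << t >> : {malg K[T]}) x = x.
Proof.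
rewrite [RHS]monalgE; apply: eq_bigr => t _; apply/malgP => t'.
by rewrite mcoeffZ !mcoeffU mulr_natr.
Qed.

End FreeModule.

Lemma linP_mlin (K : comNzRingType) (T : choiceType) (U V : lmodType K)
    (h : U -> V) (f : T -> U) x :
  linear h -> h (mlin f x) = mlin (fun t => h (f t)) x.
Proof.
move=> lh; rewrite /mlin (linP_sum lh); apply: eq_bigr => t _.
by rewrite (linPZ lh).
Qed.

(** * Sums over splittings of a list *)

Section SplitSum.
Variables (V : Type) (M : zmodType).
Implicit Types (F G : seq V -> seq V -> M) (vs : seq V).

(** The recursive form of the sum over I and J in the coproduct; [split_sum_mask] relates it to the
    sum over subsets. *)
Fixpoint split_sum F vs : M :=
  if vs is v :: us then
    split_sum (fun a b => F (v :: a) b) us +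
    split_sum (fun a b => F a (v :: b)) us
  else F [::] [::].

Lemma split_sum_ext (P : pred V) F G vs : all P vs ->
  (forall a b, all P a -> all P b -> (size a + size b = size vs)%N ->
    F a b = G a b) ->
  split_sum F vs = split_sum G vs.
Proof.
elim: vs F G => [|v us IHus] F G /= => [_|/andP[Pv Pus]] FG; first exact: FG.
congr (_ + _); apply: IHus => // a b Pa Pb ab.
  by apply: FG; rewrite /= ?Pv // addSn ab.
by apply: FG; rewrite /= ?Pv // addnS ab.
Qed.

Lemma eq_split_sum F G vs : (forall a b, F a b = G a b) ->
  split_sum F vs = split_sum G vs.
Proof. by move=> FG; apply: (split_sum_ext (P := predT)); rewrite ?all_predT. Qed.

Lemma split_sumD F G vs :
  split_sum (fun a b => F a b + G a b) vs = split_sum F vs + split_sum G vs.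
Proof. by elim: vs F G => //= v us IHus F G; rewrite !IHus addrACA. Qed.

Lemma split_sumN F vs : split_sum (fun a b => - F a b) vs = - split_sum F vs.
Proof. by elim: vs F => //= v us IHus F; rewrite !IHus opprD. Qed.

(** A replaced entry ends up in one of the two parts, so replacement may as well take place after
    the splitting. *)
Lemma repl_split_sum (act : V -> V -> V) F v vs :
  repl_sum act (split_sum F) v vs =
  split_sum (fun a b => repl_sum act (F^~ b) v a + repl_sum act (F a) v b) vs.
Proof.
elim: vs F => [|u us IHus] F /=; first by rewrite addr0.
rewrite repl_sumD !IHus !split_sumD -!addrA; congr (_ + _).
rewrite addrCA; congr (_ + _); rewrite !addrA; congr (_ + _).
by rewrite addrC addrA addrC addrA.
Qed.

Lemma split_sum_mask F vs : split_sum F vs =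
  \sum_(I : (size vs).-tuple bool) F (mask I vs) (mask (map negb I) vs).
Proof.
elim: vs F => [|v us IHus] F /=.
  by rewrite (big_pred1 [tuple]) // => t; rewrite [t]tuple0; apply/esym/eqP.
rewrite !IHus (bigID (fun I : (size us).+1.-tuple bool => thead I)) /=.
congr (_ + _).
  rewrite (reindex (fun I : (size us).-tuple bool => [tuple of true :: I])) /=.
    by apply: eq_big => // I; rewrite theadE.
  exists (fun I : (size us).+1.-tuple bool => [tuple of behead I]) => I.
    by move=> _; apply: val_inj.
  by rewrite inE => tI; apply: val_inj; case/tupleP: I tI => -[] I.
rewrite (reindex (fun I : (size us).-tuple bool => [tuple of false :: I])) /=.
  by apply: eq_big => // I; rewrite theadE.
exists (fun I : (size us).+1.-tuple bool => [tuple of behead I]) => I.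
  by move=> _; apply: val_inj.
by rewrite inE => tI; apply: val_inj; case/tupleP: I tI => -[] I.
Qed.

(** Isolates the term that a convolution identity determines; in the others the left part is
    shorter, as [split_sum_mono] makes explicit for inductions. *)
Lemma split_sum_top F vs : split_sum F vs = F vs [::] +
  split_sum (fun a b => if b is _ :: _ then F a b else 0) vs.
Proof.
by elim: vs F => [|v us IHus] F /=; rewrite ?addr0 // IHus addrA.
Qed.

Lemma split_sum_mono F vs : 
   split_sum (fun a b => if b is _ :: _ then F a b else 0) vs =
   split_sum (fun a b => if (size a < size vs)%N then F a b else 0) vs.
Proof.
apply: (split_sum_ext (P := predT)); rewrite ?all_predT // => a [|v b] _ _ <- /=.
  by rewrite addn0 ltnn.
by rewrite addnS ltnS leq_addr.
Qed.

End SplitSum.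

Lemma split_sum_morph (V : Type) (M N : zmodType) (h : M -> N) F (vs : seq V) :
  {morph h : x y / x + y} ->
  h (split_sum F vs) = split_sum (fun a b => h (F a b)) vs.
Proof. by move=> hD; elim: vs F => //= u us IHus F; rewrite hD !IHus. Qed.

Lemma split_sum_map (U V : Type) (M : zmodType) (f : U -> V)
    (F : seq V -> seq V -> M) s :
  split_sum F (map f s) = split_sum (fun a b => F (map f a) (map f b)) s.
Proof. by elim: s F => //= u s IHs F; rewrite !IHs. Qed.

Lemma split_sum_perm (T : eqType) (M : zmodType) (F : seq T -> seq T -> M) s t :
  (forall a a' b b', perm_eq a a' -> perm_eq b b' -> F a b = F a' b') ->
  perm_eq s t -> split_sum F s = split_sum F t.
Proof.
have E (G : seq T -> seq T -> M) x s1 s2 :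
    (forall a a' b b', perm_eq a a' -> perm_eq b b' -> G a b = G a' b') ->
    split_sum G (x :: s1 ++ s2) = split_sum G (s1 ++ x :: s2).
  elim: s1 G => //= y s1 IHs G GP; rewrite -!IHs /=; first last.
  - by move=> a a' b b' aa bb; apply: GP => //; rewrite perm_cons.
  - by move=> a a' b b' aa bb; apply: GP => //; rewrite perm_cons.
  rewrite addrACA; congr (_ + _ + (_ + _)); apply: eq_split_sum => a b;
    by apply: GP; rewrite //; apply/permP => p /=; rewrite addnCA.
move=> FP; elim: s t F FP => [|x s IHs] t F FP.
  by rewrite perm_sym => /perm_nilP->.
move=> st; have xt : x \in t by rewrite -(perm_mem st) mem_head.
case/splitPr: xt st => t1 t2; rewrite perm_sym perm_catC /= perm_cons perm_catC.
rewrite perm_sym -E //= => st; congr (_ + _); apply: IHs => // a a' b b' aa bb;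
  by apply: FP => //; rewrite perm_cons.
Qed.

Section Hopf.
Variables (K : comNzRingType) (k : var_kind) (I : finType).
Variables (alpha : nat) (alpha_gt0 : (0 < alpha)%N).
Local Notation op := (operator K k I).
Local Notation vfield := (I -> pseries K k I).
Local Notation good := (@vfield_ge K k I alpha).
Local Notation allgood := (@vfields_ge K k I alpha).
Local Notation act := (@vact K k I).
Local Notation B := (@Bplus_op K k I).
Local Notation D := (@diffop K k I alpha).
Implicit Types (v : vfield) (vs : seq vfield).

Lemma allgood_cons v vs : good v -> allgood vs -> allgood (v :: vs).
Proof. by move=> gv gvs; apply/andP; split=> //; apply/asboolP. Qed.

(** * Bilinear maps on the algebra of differential operators *)

Section Bilinear.
Variables (M : lmodType K) (b : op -> op -> M).
Hypothesis bb : bilinear_on D b.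

Lemma bilin0l y : D y -> b 0 y = 0.
Proof.
move=> Dy; have := bb.1 (-1) 0 0 y (diffop0 _ _ _ _) (diffop0 _ _ _ _) Dy.
by rewrite scaler0 addr0 scaleN1r addNr.
Qed.

Lemma bilin0r x : D x -> b x 0 = 0.
Proof.
move=> Dx; have := bb.2 (-1) x 0 0 Dx (diffop0 _ _ _ _) (diffop0 _ _ _ _).
by rewrite scaler0 addr0 scaleN1r addNr.
Qed.

Lemma bilinDl x x' y : D x -> D x' -> D y -> b (x + x') y = b x y + b x' y.
Proof. by move=> Dx Dx' Dy; have := bb.1 1 _ _ _ Dx Dx' Dy; rewrite !scale1r. Qed.

Lemma bilinDr x y y' : D x -> D y -> D y' -> b x (y + y') = b x y + b x y'.
Proof. by move=> Dx Dy Dy'; have := bb.2 1 _ _ _ Dx Dy Dy'; rewrite !scale1r. Qed.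

(** As [b] is additive on [D] only, membership of the partial sums in [D] is proved along with the
    identity. *)
Lemma bilin_repl_l v vs y : allgood vs -> D y -> good v ->
  b (repl_sum act B v vs) y = repl_sum act (fun l => b (B l) y) v vs.
Proof.
move=> gvs Dy gv.
suff [] : D (repl_sum act B v vs) /\
  b (repl_sum act B v vs) y = repl_sum act (fun l => b (B l) y) v vs by [].
apply: (repl_sum_rel (P := good) (Q := fun x m => D x /\ b x y = m)) => //.
- by split; [exact: diffop0 | exact: bilin0l].
- move=> x x' m m' [Dx <-] [Dx' <-]; split; first exact: diffopD.
  exact: bilinDl.
- by move=> u; exact: vact_good.
- by move=> l _ gl; split=> //; exact: diffop_Bplus.
Qed.

Lemma bilin_repl_r v vs x : allgood vs -> D x -> good v ->
  b x (repl_sum act B v vs) = repl_sum act (fun l => b x (B l)) v vs.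
Proof.
move=> gvs Dx gv.
suff [] : D (repl_sum act B v vs) /\
  b x (repl_sum act B v vs) = repl_sum act (fun l => b x (B l)) v vs by [].
apply: (repl_sum_rel (P := good) (Q := fun y m => D y /\ b x y = m)) => //.
- by split; [exact: diffop0 | exact: bilin0r].
- move=> y y' m m' [Dy <-] [Dy' <-]; split; first exact: diffopD.
  exact: bilinDr.
- by move=> u; exact: vact_good.
- by move=> l _ gl; split=> //; exact: diffop_Bplus.
Qed.

Lemma diffop_repl v vs : allgood vs -> good v -> D (repl_sum act B v vs).
Proof.
move=> gvs gv; apply: (repl_sum_closed (P := good)) => //.
- exact: diffop0.
- exact: diffopD.
- by move=> u; exact: vact_good.
- by move=> l _; exact: diffop_Bplus.
Qed.

End Bilinear.

(** * Coproduct, counit and antipode of B_+ *)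

Lemma coprod_graphD x s y t : coprod_graph alpha x s ->
  coprod_graph alpha y t -> coprod_graph alpha (x + y : op) (s + t).
Proof. by move=> xs yt; have := coprod_lin 1 xs yt; rewrite !scale1r. Qed.

Lemma coprod_graphB x s y t : coprod_graph alpha x s ->
  coprod_graph alpha y t -> coprod_graph alpha (x - y : op) (s - t).
Proof.
by move=> xs yt; have := coprod_lin (-1) yt xs; rewrite !scaleN1r ![- _ + _]addrC.
Qed.

Lemma coprod_graph0 : coprod_graph alpha (0 : op) 0.
Proof.
have := coprod_lin (-1) (coprod_one K k I alpha) (coprod_one K k I alpha).
by rewrite !scaleN1r !addNr.
Qed.

Definition Bsplit vs : {malg K[(op * op)%type]} :=
  split_sum (fun a c => tens (B a) (B c)) vs.

Lemma mlin_Bsplit (M : lmodType K) (f : op * op -> M) vs :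
  mlin f (Bsplit vs) = split_sum (fun a c => f (B a, B c)) vs.
Proof.
rewrite /Bsplit (split_sum_morph _ _ (mlinD f)).
by apply: eq_split_sum => a c; rewrite mlin_basis.
Qed.

Lemma mlin_split_tens (M : lmodType K) (b : op -> op -> M)
    (F G : seq vfield -> seq vfield -> op) vs :
  mlin (fun p => b p.1 p.2) (split_sum (fun a c => tens (F a c) (G a c)) vs) =
  split_sum (fun a c => b (F a c) (G a c)) vs.
Proof.
rewrite (split_sum_morph _ _ (mlinD _)).
by apply: eq_split_sum => a c; rewrite mlin_basis.
Qed.

Lemma tensor_mul_prim (d : op) vs :
  tensor_mul (tens id d + tens d id) (Bsplit vs) =
  split_sum (fun a c => tens (B a) (d \o B c)) vs +
  split_sum (fun a c => tens (d \o B a) (B c)) vs.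
Proof. by rewrite /tensor_mul mlinD !mlin_basis !mlin_Bsplit. Qed.

(** Multiplication by the primitive [vder v] composes it with either factor of each splitting.
    Expanding by [vder_Bplus] puts [v] into that factor, and the replacement terms cancel those
    subtracted in [Bplus_cons]. *)
Lemma coprod_Bplus vs : allgood vs -> coprod_graph alpha (B vs) (Bsplit vs).
Proof.
move: {2}(size vs) (leqnn (size vs)) => n.
elim: n vs => [|n IHn] [|v vs] //=;
  try by move=> _ _; rewrite Bplus_nil /Bsplit /= Bplus_nil; exact: coprod_one.
move=> vn /andP[/asboolP gv gvs].
have Gv : coprod_graph alpha (vder v : op) (tens id (vder v) + tens (vder v) id).
  by apply: coprod_der; exact: vder_derivation_ge.
have Gr : coprod_graph alpha (repl_sum act B v vs) (repl_sum act Bsplit v vs).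
  apply: (repl_sum_rel (P := good)) => //.
  - exact: coprod_graph0.
  - by move=> x y s t; exact: coprod_graphD.
  - by move=> u; exact: vact_good.
  - by move=> l ls gl; apply: IHn; rewrite ?ls.
have G := coprod_graphB (coprod_mul Gv (IHn vs vn gvs)) Gr.
(* [G] gives another representative, equal to [Bsplit (v :: vs)] in the tensor product only; the two
   are compared under an arbitrary bilinear [b]. *)
rewrite Bplus_cons; apply: (coprod_eq G) => M b bb.
have gD := @diffop_Bplus K k I alpha alpha_gt0.
set L := mlin _; have LD : {morph L : x y / x + y} by exact: mlinD.
have -> : L (Bsplit (v :: vs)) =
    split_sum (fun a c => b (B (v :: a)) (B c) + b (B a) (B (v :: c))) vs.
  by rewrite /L mlin_split_tens split_sumD.
rewrite tensor_mul_prim !LD /L mlinN !mlin_split_tens -/L.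
have -> : L (repl_sum act Bsplit v vs) =
    repl_sum act (split_sum (fun a c => b (B a) (B c))) v vs.
  rewrite (repl_sum_morph _ (h := L)) //; last exact: mlin0.
  by apply: repl_sum_ext => l _; rewrite /L mlin_split_tens.
rewrite repl_split_sum -split_sumD -split_sumN -split_sumD.
apply: (split_sum_ext (P := fun u => `[< good u >])) => // a c ga gc _.
rewrite -(bilin_repl_l bb) //; last exact: gD.
rewrite -(bilin_repl_r bb) //; last exact: gD.
have Dc l : allgood l -> D (B (v :: l)).
  by move=> gl; apply: gD; exact: allgood_cons.
have Dr l : allgood l -> D (repl_sum act B v l) by move=> gl; exact: diffop_repl.
have [Da Da' Dr_a] := And3 (gD a ga) (Dc a ga) (Dr a ga).
have [Db Db' Dr_c] := And3 (gD c gc) (Dc c gc) (Dr c gc).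
rewrite !vder_Bplus (bilinDr bb) // (bilinDl bb) //.
by rewrite addrACA [X in _ - X]addrC addrK addrC.
Qed.

Lemma counit_graph0 : counit_graph alpha (0 : op) 0.
Proof. by apply: counit_der; exact: derivation_ge0. Qed.

Lemma counit_graphD (x y : op) c d : counit_graph alpha x c ->
  counit_graph alpha y d -> counit_graph alpha (x + y) (c + d).
Proof. by move=> xc yd; have := counit_lin 1 xc yd; rewrite scale1r mul1r. Qed.

Lemma counit_graphB (x y : op) c d : counit_graph alpha x c ->
  counit_graph alpha y d -> counit_graph alpha (x - y) (c - d).
Proof.
move=> xc yd; have := counit_lin (-1) yd xc.
by rewrite scaleN1r mulN1r ![- _ + _]addrC.
Qed.

Lemma counit_Bplus vs : allgood vs -> counit_graph alpha (B vs) (nilp vs)%:R.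
Proof.
move: {2}(size vs) (leqnn (size vs)) => n.
elim: n vs => [|n IHn] [|v vs] //=;
  try by move=> _ _; rewrite Bplus_nil; exact: counit_one.
move=> vn /andP[/asboolP gv gvs]; rewrite Bplus_cons.
(* The replacement sum vanishes: it is empty, or all its lists are nonempty. *)
have -> : (nilp (v :: vs))%:R = 0 * (nilp vs)%:R -
    repl_sum act (fun l => (nilp l)%:R) v vs :> K.
  rewrite mul0r sub0r; case: vs {vn gvs} => [|u us] /=; first by rewrite oppr0.
  by rewrite repl_sum0 addr0 oppr0.
apply: counit_graphB.
  apply: counit_mul; last exact: IHn.
  by apply: counit_der; exact: vder_derivation_ge.
apply: (repl_sum_rel (P := good)) => //.
- exact: counit_graph0.
- by move=> x y c d; exact: counit_graphD.
- by move=> u; exact: vact_good.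
- by move=> l ls gl; apply: IHn; rewrite ?ls.
Qed.

(* An anti-morphism with value - delta at each derivation delta takes this
   value at Bplus_op vs, by Bplus_cons; the fuel n is the length of vs. *)
Fixpoint Banti_rec (n : nat) vs : op :=
  match n, vs with
  | n'.+1, v :: us =>
      Banti_rec n' us \o (- vder v : op) - repl_sum act (Banti_rec n') v us
  | _, _ => id
  end.

Definition Banti vs := Banti_rec (size vs) vs.

Lemma Banti_cons v vs : Banti (v :: vs) =
  Banti vs \o (- vder v : op) - repl_sum act Banti v vs.
Proof.
rewrite /Banti /=; congr (_ - _); apply: repl_sum_ext => l ls.
by rewrite ls.
Qed.

Lemma antipode_graph0 : antipode_graph alpha (0 : op) 0.
Proof.
rewrite -[X in antipode_graph _ _ X]oppr0; apply: antipode_der.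
exact: derivation_ge0.
Qed.

Lemma antipode_graphD (x y x' y' : op) : antipode_graph alpha x x' ->
  antipode_graph alpha y y' -> antipode_graph alpha (x + y) (x' + y').
Proof. by move=> xc yd; have := antipode_lin 1 xc yd; rewrite !scale1r. Qed.

Lemma antipode_graphB (x y x' y' : op) : antipode_graph alpha x x' ->
  antipode_graph alpha y y' -> antipode_graph alpha (x - y) (x' - y').
Proof.
move=> xc yd; have := antipode_lin (-1) yd xc.
by rewrite !scaleN1r ![- _ + _]addrC.
Qed.

Lemma antipode_Bplus vs : allgood vs -> antipode_graph alpha (B vs) (Banti vs).
Proof.
move: {2}(size vs) (leqnn (size vs)) => n.
elim: n vs => [|n IHn] [|v vs] //=;
  try by move=> _ _; rewrite Bplus_nil; exact: antipode_one.
move=> vn /andP[/asboolP gv gvs]; rewrite Bplus_cons Banti_cons.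
apply: antipode_graphB.
  apply: antipode_mul; last exact: IHn.
  by apply: antipode_der; exact: vder_derivation_ge.
apply: (repl_sum_rel (P := good)) => //.
- exact: antipode_graph0.
- by move=> x y c d; exact: antipode_graphD.
- by move=> u; exact: vact_good.
- by move=> l ls gl; apply: IHn; rewrite ?ls.
Qed.

(** Composition is not additive in its right factor for arbitrary maps; this makes it so when the
    left factor is [Banti vs]. *)
Lemma antipode_graph_linear (x y : op) : antipode_graph alpha x y ->
  linear y.
Proof.
elim=> {x y} [//|d [[ld _] _]|a x x' y y' _ lx _ ly|x x' y y' _ lx _ ly].
- move=> a f g; rewrite -[LHS]/(- d (a *: f + g)) ld opprD -scalerN //.
- move=> b f g; rewrite -[LHS]/(a *: x' (b *: f + g) + y' (b *: f + g)) lx ly.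
  rewrite -[(a *: x' + y') f]/(a *: x' f + y' f).
  rewrite -[(a *: x' + y') g]/(a *: x' g + y' g).
  by rewrite !scalerDr !scalerA [a * b]mulrC addrACA.
- by move=> a f g /=; rewrite lx ly.
Qed.

Lemma Banti_linear vs : allgood vs -> linear (Banti vs).
Proof. by move=> gvs; exact: antipode_graph_linear (antipode_Bplus gvs). Qed.

(** [Banti] is a left convolution inverse of [B]. When [v] is added, the two terms with [vder v] in
    the middle cancel, and what remains is minus the replacement sum of the same identity for
    [vs]. *)
Lemma Banti_conv vs : allgood vs ->
  split_sum (fun a c => Banti a \o B c : op) vs = (nilp vs)%:R *: (id : op).
Proof.
move: {2}(size vs) (leqnn (size vs)) => n.
elim: n vs => [|n IHn] [|v vs] //=; rewrite ?Bplus_nil ?scale1r //.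
move=> vn /andP[/asboolP gv gvs]; rewrite -split_sumD scale0r.
have := repl_split_sum act (fun a c => Banti a \o B c : op) v vs.
(* The induction hypothesis applies to each replaced list, which is nonempty and as long as [vs]. *)
have -> : repl_sum act (split_sum (fun a c => Banti a \o B c : op)) v vs = 0.
  case: vs vn gvs => // u us vn gvs.
  apply: (repl_sum_closed (P := good) (Q := fun x => x = 0)) => //.
  - by move=> x y -> ->; rewrite addr0.
  - by move=> w; exact: vact_good.
  - by move=> l ls gl; rewrite IHn ?ls //; case: l ls {gl} => // *; rewrite scale0r.
move=> E; rewrite -[RHS]oppr0 [X in - X]E -split_sumN.
apply: (split_sum_ext (P := fun u => `[< good u >])) => // a c ga gc _.
have lA := Banti_linear ga.
rewrite Banti_cons Bplus_cons; apply/funext => f.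
have -> : repl_sum act (fun x => Banti x \o B c : op) v a =
    repl_sum act Banti v a \o B c.
  by rewrite (repl_sum_morph _ (h := fun x : op => x \o B c : op)).
have -> : repl_sum act (fun l => Banti a \o B l : op) v c =
    Banti a \o repl_sum act B v c.
  rewrite (repl_sum_morph _ (h := fun x : op => Banti a \o x : op)) //.
    by apply/funext => g; exact: (linP0 lA).
  by move=> x y; apply/funext => g; exact: (linPD lA).
rewrite -[LHS]/(Banti a (- vder v (B c f)) - repl_sum act Banti v a (B c f) +
  Banti a (vder v (B c f) - repl_sum act B v c f)).
rewrite -[RHS]/(- (repl_sum act Banti v a (B c f) + Banti a (repl_sum act B v c f))).
rewrite (linPN lA) (linPD lA) (linPN lA) opprD addrA; congr (_ - _).
by rewrite addrAC addNr add0r.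
Qed.

Section Permutation.
Variables (T : eqType) (F : T -> vfield).

(** The recursion of [Banti] depends on the order of the list, but the convolution identity is
    symmetric and determines [Banti] from shorter lists. *)
Lemma Banti_perm s t : allgood (map F s) -> perm_eq s t ->
  Banti (map F s) = Banti (map F t).
Proof.
move: {2}(size s) (leqnn (size s)) => n.
elim: n s t => [|n IHn] s t sn gs st.
  by move: sn st; rewrite leqn0 => /nilP->; rewrite perm_sym => /perm_nilP->.
have gt : allgood (map F t) by rewrite /vfields_ge all_map -(perm_all _ st) -all_map.
(* The identity solved for its top term. The test [allgood (map F a)] is put into the summand
   because [split_sum_perm] considers arbitrary lists. *)
have E r : allgood (map F r) -> Banti (map F r) = (nilp r)%:R *: (id : op) -
    split_sum (fun a c => if (size a < size r)%N && allgood (map F a)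
      then Banti (map F a) \o B (map F c) : op else 0) r.
  move=> gr; have := Banti_conv gr; rewrite split_sum_map split_sum_top Bplus_nil.
  rewrite split_sum_mono /nilp size_map => <-.
  rewrite [X in _ - X](split_sum_ext (P := fun x => `[< good (F x) >])
    (G := fun a c => if (size a < size r)%N then Banti (map F a) \o B (map F c)
                     else 0)); first by rewrite addrK.
    by rewrite -(all_map F (fun u => `[< good u >])).
  by move=> a c ga gc _; rewrite /vfields_ge all_map [all _ a]ga andbT.
rewrite (E s gs) (E t gt) /nilp (perm_size st); congr (_ - _).
have ts := perm_size st; apply: split_sum_perm st => a a' c c' aa' cc'.
have -> : allgood (map F a') = allgood (map F a).
  by rewrite /vfields_ge !all_map (perm_all _ aa').
rewrite (perm_size aa'); case: ifP => // /andP[a't ga].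
rewrite (Bplus_perm F cc') (IHn a a') // (perm_size aa') -ltnS.
by rewrite (leq_trans a't) // -ts.
Qed.

End Permutation.

End Hopf.

(** * Grafting *)

(** The generated principle gives no induction hypothesis for the children, which are nested in a
    list. *)
Lemma ptree_ind_mem (P : ptree -> Prop) :
  (forall m s, (forall U, U \in s -> P U) -> P (PNode m s)) -> forall T, P T.
Proof.
move=> IH; fix rec 1 => -[m s]; apply: IH; elim: s => [|T s IHs] U.
  by clear rec; rewrite in_nil.
by rewrite in_cons => /predU1P[->|]; [exact: rec | exact: IHs].
Qed.

(** Names the local fixpoint of [vertices], with any starting position, for inductions on forests;
    [graft_forest] and [Pgraft_forest] serve the same purpose. *)
Fixpoint forest_vertices (j : nat) (s : seq ptree) : seq (seq nat) :=
  if s is U :: s' then map (cons j) (vertices U) ++ forest_vertices j.+1 s'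
  else [::].

Lemma verticesE m s : vertices (PNode m s) = [::] :: forest_vertices 0 s.
Proof. by []. Qed.

Definition graft_forest (g : seq nat -> seq ptree) :=
  fix graft_in (j : nat) (s : seq ptree) : seq ptree :=
    if s is U :: s' then
      graft (fun p => g (j :: p)) U :: graft_in j.+1 s'
    else [::].

Lemma graftE g m s : graft g (PNode m s) = PNode m (g [::] ++ graft_forest g 0 s).
Proof. by []. Qed.

Lemma forest_vertices_head j s p : p \in forest_vertices j s ->
  exists i q, p = i :: q /\ (j <= i)%N.
Proof.
elim: s j => //= U s IHs j; rewrite mem_cat => /orP[/mapP[q _ ->]|/IHs].
  by exists j, q.
by move=> [i [q [-> /ltnW ji]]]; exists i, q.
Qed.

Lemma vertices_uniq T : uniq (vertices T).
Proof.
elim/ptree_ind_mem: T => m s IHs; rewrite verticesE cons_uniq.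
apply/andP; split.
  by apply/negP => /forest_vertices_head[i [q []]].
elim: s 0%N IHs => //= U s IHs j H; rewrite cat_uniq map_inj_uniq; last by move=> p q [].
rewrite H ?mem_head // IHs ?andbT => [|T Ts]; last by rewrite H // in_cons Ts orbT.
apply/hasPn => p /forest_vertices_head[i [q [-> ji]]].
by apply/mapP => -[q' _ [E _]]; rewrite E ltnn in ji.
Qed.

Definition set_at (X : Type) (p : seq nat) (l : seq X) (G : seq nat -> seq X) :=
  fun q => if q == p then l else G q.

Lemma set_at_set (X : Type) p (l l' : seq X) G :
  set_at p l (set_at p l' G) = set_at p l G.
Proof. by apply/funext => q; rewrite /set_at; case: eqP. Qed.

Lemma set_at_swap (X : Type) p q (l l' : seq X) G : p != q ->
  set_at p l (set_at q l' G) = set_at q l' (set_at p l G).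
Proof.
move=> pq; apply/funext => r; rewrite /set_at.
by case: eqP => // ->; rewrite (negbTE pq).
Qed.

Lemma set_at_eq (X : Type) p (l : seq X) G : set_at p l G p = l.
Proof. by rewrite /set_at eqxx. Qed.

Lemma set_at_neq (X : Type) p q (l : seq X) G : q != p -> set_at p l G q = G q.
Proof. by rewrite /set_at => /negbTE->. Qed.

Lemma set_at_cons (X : Type) j p (l : seq X) G :
  (fun q => set_at (j :: p) l G (j :: q)) = set_at p l (fun q => G (j :: q)).
Proof. by apply/funext => q; rewrite /set_at eqseq_cons eqxx. Qed.

(** * Sums over all ways to attach a list to vertices *)

Section GraftSum.
Variables (X : Type) (M : zmodType) (V : seq (seq nat)).
Implicit Types (Psi : (seq nat -> seq X) -> M) (G : seq nat -> seq X).

(** The sum over all maps from the entries of [vs] to [V], where [G p] lists the entries sent to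
    [p]; [graft_sum_ffun] identifies it with the indexing of the Grossman-Larson product. *)
Fixpoint graft_sum Psi (vs : seq X) : M :=
  if vs is v :: us then
    graft_sum (fun G => \sum_(p <- V) Psi (set_at p (v :: G p) G)) us
  else Psi (fun=> [::]).

Lemma eq_graft_sum Psi Psi' vs : (forall G, Psi G = Psi' G) ->
  graft_sum Psi vs = graft_sum Psi' vs.
Proof. by move=> /funext->. Qed.

Lemma graft_sumD Psi Psi' vs :
  graft_sum (fun G => Psi G + Psi' G) vs = graft_sum Psi vs + graft_sum Psi' vs.
Proof.
elim: vs Psi Psi' => //= v us IHus Psi Psi'; rewrite -IHus.
by apply: eq_graft_sum => G; rewrite big_split.
Qed.

Lemma repl_graft_sum (act : X -> X -> X) Psi v vs : uniq V ->
  repl_sum act (graft_sum Psi) v vs =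
  graft_sum (fun G => \sum_(p <- V)
    repl_sum act (fun l => Psi (set_at p l G)) v (G p)) vs.
Proof.
move=> uV; elim: vs Psi => [|w us IHus] Psi /=.
  by rewrite big1_seq.
rewrite IHus -graft_sumD; apply: eq_graft_sum => G.
under [X in _ + X]eq_bigr do rewrite repl_sum_bigsum.
rewrite exchange_big -big_split big_seq [RHS]big_seq; apply: eq_bigr => p pV /=.
(* [p] is the vertex that receives [w]. The replaced entry is [w] itself, another entry at [p], or
   an entry at a vertex [q] other than [p]. *)
rewrite (bigD1_seq p) //= [RHS](bigD1_seq p) //= set_at_eq /= !addrA.
congr (_ + _ + _).
- by rewrite !set_at_set.
- by apply: repl_sum_ext => l _; rewrite !set_at_set set_at_eq.
apply: eq_bigr => q qp; rewrite set_at_neq //; apply: repl_sum_ext => l _.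
by rewrite set_at_neq 1?eq_sym // set_at_swap // eq_sym.
Qed.

Lemma graft_sum_ffun Psi vs : graft_sum Psi vs =
  \sum_(f : {ffun 'I_(size vs) -> 'I_(size V)})
    Psi (fun p => [seq tnth (in_tuple vs) i
                  | i <- enum 'I_(size vs) & nth [::] V (f i) == p]).
Proof.
elim: vs Psi => [|v us IHus] Psi.
  rewrite [enum _](size0nil (s := enum 'I_0)) ?size_enum_ord //=.
  rewrite (big_pred1 (ffun0 (card_ord 0))) //.
  by move=> f /=; apply/esym/eqP/ffunP => -[].
rewrite [LHS]IHus.
(* A map on the entries of [v :: us] is a vertex for [v] together with a map on those of [us]. *)
pose h (pf : 'I_(size V) * {ffun 'I_(size us) -> 'I_(size V)}) :
    {ffun 'I_(size us).+1 -> 'I_(size V)} :=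
  [ffun i => oapp pf.2 pf.1 (unlift ord0 i)].
rewrite (reindex h) /=; last first.
  exists (fun f => (f ord0, [ffun i => f (lift ord0 i)])) => [[p f] _|f _].
    rewrite /h !ffunE unlift_none /=; congr pair; apply/ffunP => i.
    by rewrite !ffunE liftK.
  by apply/ffunP => i; rewrite !ffunE; case: unliftP => [j|] -> /=; rewrite ?ffunE.
rewrite -(pair_bigA _ (fun p f => Psi (fun q => [seq tnth (in_tuple (v :: us)) i
   | i <- enum 'I_(size us).+1 & nth [::] V (h (p, f) i) == q]))) /= exchange_big.
rewrite (big_nth [::]) big_mkord; apply: eq_bigr => p _; apply: eq_bigr => f _.
congr Psi; apply/funext => q; rewrite /set_at enum_ordSl /= /h ffunE unlift_none /=.
rewrite eq_sym; case: eqP => [q_p|_] /=; [rewrite q_p; congr (_ :: _)|];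
  rewrite filter_map -map_comp;
  rewrite [in RHS](@eq_filter _ _ (fun i => nth [::] V (f i) == q)) => [|i];
  by [apply: eq_map => i; rewrite /= !(tnth_nth v) | rewrite /= ffunE liftK].
Qed.

End GraftSum.

Lemma graft_sum_map (X Y : Type) (M : zmodType) (V : seq (seq nat)) (F : X -> Y)
    (Psi : (seq nat -> seq Y) -> M) s :
  graft_sum V Psi (map F s) = graft_sum V (fun G => Psi (map F \o G)) s.
Proof.
elim: s Psi => //= x s IHs Psi; rewrite IHs; apply: eq_graft_sum => G.
apply: eq_bigr => p _; congr Psi; apply/funext => q /=.
by rewrite /set_at; case: eqP.
Qed.

Lemma graft_sum_morph (X : Type) (M N : zmodType) (h : M -> N) V
    (Psi : (seq nat -> seq X) -> M) vs : h 0 = 0 -> {morph h : x y / x + y} ->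
  h (graft_sum V Psi vs) = graft_sum V (fun G => h (Psi G)) vs.
Proof.
move=> h0 hD; elim: vs Psi => //= v us IHus Psi; rewrite IHus.
by apply: eq_graft_sum => G; apply: big_morph.
Qed.

(** * Vector fields of trees under grafting *)

Section TreeFields.
Variables (K : comNzRingType) (k : var_kind) (I : finType).
Variable H : nat -> I -> pseries K k I.
Local Notation op := (operator K k I).
Local Notation vfield := (I -> pseries K k I).
Local Notation act := (@vact K k I).
Local Notation B := (@Bplus_op K k I).
Implicit Types (v : vfield) (G : seq nat -> seq vfield).

Lemma PtreeE m s : Ptree H (PNode m s) = fun i => B (map (Ptree H) s) (H m i).
Proof. by case: s => //=; apply/funext => i; rewrite Bplus_nil. Qed.

(* P_T for the tree T with additional subtrees at each vertex p, given only by
   their vector fields, the entries of G p. *)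
Fixpoint Pgraft G (T : ptree) : vfield :=
  let: PNode m s := T in fun i =>
    B (G [::] ++
      (fix Pgraft_in (j : nat) (s : seq ptree) : seq vfield :=
         if s is U :: s' then
           Pgraft (fun p => G (j :: p)) U :: Pgraft_in j.+1 s'
         else [::]) 0%N s) (H m i).

Definition Pgraft_forest G :=
  fix Pgraft_in (j : nat) (s : seq ptree) : seq vfield :=
    if s is U :: s' then
      Pgraft (fun p => G (j :: p)) U :: Pgraft_in j.+1 s'
    else [::].

Definition Bgraft G s : op := B (G [::] ++ Pgraft_forest G 0 s).

Lemma PgraftE G m s : Pgraft G (PNode m s) = fun i => Bgraft G s (H m i).
Proof. by []. Qed.

Lemma Pgraft_forest0 j s : (forall U, U \in s -> Pgraft (fun=> [::]) U = Ptree H U) ->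
  Pgraft_forest (fun=> [::]) j s = map (Ptree H) s.
Proof.
elim: s j => //= U s IHs j E; rewrite E ?mem_head // IHs // => T Ts.
by rewrite E // in_cons Ts orbT.
Qed.

Lemma Pgraft0 T : Pgraft (fun=> [::]) T = Ptree H T.
Proof.
elim/ptree_ind_mem: T => m s IHs; rewrite PgraftE PtreeE /Bgraft /=.
by rewrite Pgraft_forest0.
Qed.

Lemma Bgraft0 s : Bgraft (fun=> [::]) s = B (map (Ptree H) s).
Proof. by rewrite /Bgraft /= Pgraft_forest0 // => U _; exact: Pgraft0. Qed.

Lemma Ptree_graft_forest g j s :
  (forall U g, U \in s -> Ptree H (graft g U) = Pgraft (map (Ptree H) \o g) U) ->
  map (Ptree H) (graft_forest g j s) = Pgraft_forest (map (Ptree H) \o g) j s.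
Proof.
elim: s j => //= U s IHs j E; rewrite E ?mem_head // IHs // => T h Ts.
by rewrite E // in_cons Ts orbT.
Qed.

Lemma Ptree_graft g T : Ptree H (graft g T) = Pgraft (map (Ptree H) \o g) T.
Proof.
elim/ptree_ind_mem: T g => m s IHs g; rewrite graftE PtreeE PgraftE /Bgraft.
by rewrite map_cat Ptree_graft_forest // => U h /IHs.
Qed.

Lemma Bplus_graft g s :
  B (map (Ptree H) (g [::] ++ graft_forest g 0 s)) =
  Bgraft (map (Ptree H) \o g) s.
Proof.
by rewrite map_cat Ptree_graft_forest // => U h _; exact: Ptree_graft.
Qed.

Lemma Pgraft_forest_eq G G' j s :
  (forall i p, (j <= i)%N -> G (i :: p) = G' (i :: p)) ->
  Pgraft_forest G j s = Pgraft_forest G' j s.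
Proof.
elim: s j => //= U s IHs j E; congr (_ :: _).
  by congr Pgraft; apply/funext => p; exact: E.
by apply: IHs => i p /ltnW; exact: E.
Qed.

(** Needed to expand an entry that is itself a sum over the vertices of a subtree. *)
Definition multiadd (M : zmodType) (Phi : seq vfield -> M) : Prop :=
  forall s1 s2, Phi (s1 ++ 0 :: s2) = 0 /\
    forall u v, Phi (s1 ++ (u + v) :: s2) = Phi (s1 ++ u :: s2) + Phi (s1 ++ v :: s2).

Lemma vder_addl (J : finType) (f : pseries K k J) (a b : J -> pseries K k J) :
  vder (fun i => a i + b i) f = vder a f + vder b f.
Proof.
apply: (der_along_ext (r := id) (G := fun f => vder a f + vder b f)) f.
- exact: der_vder.
- by apply: der_add; exact: der_vder.
by move=> i; rewrite !vder_var.
Qed.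

Lemma Bplus_multiadd s f : multiadd (fun l => B (s ++ l) f).
Proof.
move=> s1 s2; rewrite /Bplus_op.
have E (v : vfield) (g : pseries K k (I + I)%type) :
    foldr (@vder_w K k I) g (s ++ s1 ++ v :: s2) =
    foldr (@vder_w K k I) (vder_w v (foldr (@vder_w K k I) g s2)) (s ++ s1).
  by rewrite catA foldr_cat.
have F0 l : foldr (@vder_w K k I) 0 l = 0.
  by elim: l => //= u l ->; exact: vder_w0.
have FD l : {morph (fun g => foldr (@vder_w K k I) g l) : x y / x + y}.
  by elim: l => //= u l IHl x y; rewrite IHl vder_wD.
split=> [|u v]; rewrite !E.
  rewrite (_ : vder_w 0 _ = 0) ?F0 ?rename0 // /vder_w.
  rewrite -[RHS](vder0 (foldr (@vder_w K k I) (ps_rename inl f) s2)).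
  congr vder; apply/funext => -[i|//]; exact: rename0.
rewrite -renameD -FD; congr (ps_rename _ (foldr _ _ _)); rewrite /vder_w -vder_addl.
congr vder; apply/funext => -[i|i] /=; first exact: renameD.
by rewrite addr0.
Qed.

Lemma multiadd_sum (M : zmodType) (Phi : seq vfield -> M) (J : Type) (r : seq J)
    (F : J -> vfield) s : multiadd Phi ->
  Phi ((\sum_(j <- r) F j) :: s) = \sum_(j <- r) Phi (F j :: s).
Proof.
move=> aP; apply: (big_morph (fun u => Phi (u :: s))) => [u v|].
  by have [_ ->] := aP [::] s.
by have [->] := aP [::] s.
Qed.

(* What a derivation along v does to a list of attached vector fields at one
   vertex: it attaches v there, or it differentiates one of them. *)
Definition attach (M : zmodType) v (Phi : seq vfield -> M) (l : seq vfield) : M :=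
  Phi (v :: l) + repl_sum act Phi v l.

Lemma attach_morph (M N : zmodType) (h : M -> N) v Phi l :
  h 0 = 0 -> {morph h : x y / x + y} ->
  h (attach v Phi l) = attach v (fun l => h (Phi l)) l.
Proof. by move=> h0 hD; rewrite /attach hD (repl_sum_morph _ _ _ _ h0 hD). Qed.

Lemma vder_Bplus_attach v l f :
  vder v (B l f) = attach v (fun l => B l f) l.
Proof.
have := congr1 (fun F : op => F f) (vder_Bplus v l) => /= ->.
by rewrite /attach -(repl_sum_morph _ (h := fun F : op => F f)).
Qed.

Lemma repl_sum_forest (M : zmodType) (Phi : seq vfield -> M) v G j s :
  multiadd Phi ->
  (forall U G, U \in s -> act v (Pgraft G U) =
    \sum_(p <- vertices U) attach v (fun l => Pgraft (set_at p l G) U) (G p)) ->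
  repl_sum act Phi v (Pgraft_forest G j s) =
  \sum_(p <- forest_vertices j s)
    attach v (fun l => Phi (Pgraft_forest (set_at p l G) j s)) (G p).
Proof.
elim: s j Phi => [|U s IHs] j Phi aP HU /=; first by rewrite big_nil.
rewrite big_cat big_map HU ?mem_head // multiadd_sum // IHs; first last.
- by move=> T h Ts; apply: HU; rewrite in_cons Ts orbT.
- by move=> s1 s2; exact: (aP (_ :: s1) s2).
congr (_ + _).
  apply: eq_bigr => p _.
  rewrite (attach_morph (h := fun u => Phi (u :: _))).
  - congr (attach _ _ _); apply/funext => l; rewrite set_at_cons; congr (Phi (_ :: _)).
    apply: Pgraft_forest_eq => i q ji; rewrite set_at_neq //.
    by rewrite eqseq_cons gtn_eqF.
  - by have [] := aP [::] (Pgraft_forest G j.+1 s).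
  - by have [] := aP [::] (Pgraft_forest G j.+1 s).
(* Vertices of the later trees start with a position above [j], so an update there does not affect
   [U]. *)
rewrite !big_seq; apply: eq_bigr => p /forest_vertices_head[i [q [-> ji]]].
congr (attach _ _ _); apply/funext => l; congr (Phi (Pgraft _ _ :: _)).
by apply/funext => r; rewrite set_at_neq // eqseq_cons ltn_eqF.
Qed.

Lemma vder_Bgraft v G s f :
  (forall U G, U \in s -> act v (Pgraft G U) =
    \sum_(p <- vertices U) attach v (fun l => Pgraft (set_at p l G) U) (G p)) ->
  vder v (Bgraft G s f) = \sum_(p <- [::] :: forest_vertices 0 s)
    attach v (fun l => Bgraft (set_at p l G) s f) (G p).
Proof.
move=> HU; rewrite vder_Bplus_attach {1}/attach repl_sum_cat big_cons addrA.
congr (_ + _).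
rewrite (repl_sum_forest _ _ (@Bplus_multiadd _ f)) //.
rewrite !big_seq; apply: eq_bigr => p /forest_vertices_head[i [q [-> ji]]].
by [].
Qed.

(** Induction on [T]: at the root [vder_Bgraft] either attaches [v], differentiates an attached
    field, or differentiates the field of a child, to which the induction hypothesis applies. *)
Lemma vact_Pgraft v G T : act v (Pgraft G T) =
  \sum_(p <- vertices T) attach v (fun l => Pgraft (set_at p l G) T) (G p).
Proof.
elim/ptree_ind_mem: T G => m s IHs G; apply/funext => i.
rewrite /vact PgraftE vder_Bgraft; last by move=> U h /IHs.
rewrite verticesE.
pose ev := fun u : vfield => u i.
rewrite -[RHS]/(ev (\sum_(p <- [::] :: forest_vertices 0 s)
   attach v (fun l => Pgraft (set_at p l G) (PNode m s)) (G p))).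
rewrite (big_morph ev (id1 := 0) (op1 := +%R)) //; apply: eq_bigr => p _.
by rewrite (attach_morph (h := ev)).
Qed.

(** The analytic form of the Grossman-Larson product. In [Bplus_cons], applying [vder v] attaches
    [v] or differentiates an attached field; by [repl_graft_sum] the subtracted sum removes exactly
    the latter terms. *)
Lemma Bplus_Bgraft vs s f :
  B vs (B (map (Ptree H) s) f) =
  graft_sum ([::] :: forest_vertices 0 s) (fun G => Bgraft G s f) vs.
Proof.
have uV : uniq ([::] :: forest_vertices 0 s).
  by rewrite -(verticesE 0); exact: vertices_uniq.
move: {2}(size vs) (leqnn (size vs)) => n.
elim: n vs => [|n IHn] [|v vs] //=; try by rewrite Bplus_nil -Bgraft0.
move=> vn; rewrite Bplus_cons.
set X := B (map (Ptree H) s) f.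
have -> : (vder v \o B vs - repl_sum act B v vs : op) X =
    vder v (B vs X) - repl_sum act (fun l => B l X) v vs.
  by rewrite -(repl_sum_morph _ (h := fun F : op => F X)).
rewrite IHn // (graft_sum_morph (h := vder v)); first last.
- exact: vderD.
- exact: vderr0.
rewrite (repl_sum_ext _ _ (Psi := graft_sum ([::] :: forest_vertices 0 s)
   (fun G => Bgraft G s f))); last by move=> l ls; rewrite IHn ?ls.
rewrite repl_graft_sum //; apply/eqP; rewrite subr_eq -graft_sumD; apply/eqP.
apply: eq_graft_sum => G; rewrite vder_Bgraft; last by move=> U h _; exact: vact_Pgraft.
by rewrite -big_split.
Qed.

End TreeFields.

Local Open Scope quotient_scope.

(** * The homomorphism *)

Lemma repr_pi_iso T : ptree_iso (repr (\pi_rtree T)) T.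
Proof. by apply/asboolP; apply/(eqmodP ptree_iso_equiv); rewrite reprK. Qed.

(** The representative of [Bplus s] is chosen arbitrarily, so its branches are [s] only up to order
    and isomorphism. *)
Lemma branches_Bplus s : exists2 s',
  perm_eq s s' & pforest_iso s' (branches (Bplus s)).
Proof.
have := ptree_iso_sym (repr_pi_iso (PNode 0 s)).
rewrite /branches /Bplus; case: (repr _) => m t ST.
by inversion ST as [? s1 s2 t1 ss' s't]; subst; exists s2.
Qed.

Lemma plabel_repr_pi T : plabel (repr (\pi_rtree T)) = plabel T.
Proof.
have := repr_pi_iso T; case: (repr _) => m t; case: T => m' s ST.
by inversion ST.
Qed.

Lemma Bplus_branches W T : is_barT W T -> Bplus (branches T) = T.
Proof.
rewrite /Bplus /branches => /andP[/eqP + _]; case E: (repr T) => [m s] /= m0.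
by rewrite -m0 -E reprK.
Qed.

Lemma nilp_map (X Y : Type) (f : X -> Y) s : nilp (map f s) = nilp s.
Proof. by case: s. Qed.

(** * Labels under isomorphism *)

Section Labels.
Variable W : pred nat.
Local Notation labW := (fun T : ptree => all W (plabels T)).

Lemma plabelsE m s : all W (plabels (PNode m s)) = W m && all labW s.
Proof. by rewrite /=; congr (_ && _); elim: s => //= T s <-; rewrite all_cat. Qed.

Lemma all_plabels_forest s t : pforest_iso s t -> all labW s = all labW t.
Proof.
apply: (@pforest_iso_mind (fun S T => labW S = labW T)
  (fun s t => all labW s = all labW t)) => {s t} //.
  by move=> m s s' t ss' _ E; rewrite !plabelsE -E (perm_all _ ss').
by move=> S T s t _ ST _ st /=; rewrite ST st.
Qed.

Lemma is_barT_Bplus s : is_barT W (Bplus s) = all labW s.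
Proof.
rewrite /is_barT (plabel_repr_pi (PNode 0 s)) eqxx /=.
by have [s' ss' /all_plabels_forest <-] := branches_Bplus s; rewrite (perm_all _ ss').
Qed.

End Labels.

Section TreeOperators.
Variables (K : comNzRingType) (k : var_kind) (I : finType).
Variable H : nat -> I -> pseries K k I.
Local Notation op := (operator K k I).
Local Notation B := (@Bplus_op K k I).
Local Notation P := (Ptree H).

Lemma Ptree_forest_iso s t : pforest_iso s t -> map P s = map P t.
Proof.
apply: (@pforest_iso_mind (fun S T => P S = P T)
  (fun s t => map P s = map P t)) => {s t} //.
  by move=> m s s' t ss' _ E; rewrite !PtreeE -E (Bplus_perm _ ss').
by move=> S T s t _ ST _ st /=; rewrite ST st.
Qed.

Lemma DtreeE T : Dtree H T = B (map P (branches T)) :> op.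
Proof. by rewrite /Dtree; case: (branches T) => //=; rewrite Bplus_nil. Qed.

Lemma Dtree_pi m s : Dtree H (\pi_rtree (PNode m s)) = B (map P s) :> op.
Proof.
rewrite DtreeE /branches; have := ptree_iso_sym (repr_pi_iso (PNode m s)).
case: (repr _) => m' t ST; inversion ST as [? s1 s2 t1 ss' s't]; subst.
by rewrite (Bplus_perm _ ss') (Ptree_forest_iso s't).
Qed.

Lemma Dtree_Bplus s : Dtree H (Bplus s) = B (map P s) :> op.
Proof. exact: Dtree_pi. Qed.

Lemma AF_linear : linear (AF H : _ -> op).
Proof. exact: mlin_linear. Qed.

Lemma AF_basis T : AF H << T >> = Dtree H T :> op.
Proof. exact: mlin_basis. Qed.

Lemma op_sum (J : Type) (r : seq J) (Q : pred J) (F : J -> op) f :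
  (\sum_(j <- r | Q j) F j) f = \sum_(j <- r | Q j) F j f.
Proof. by elim/big_rec2: _ => // j x y _ <-. Qed.

(** [Bplus_Bgraft] indexed by maps from branches to vertices; [Bplus_graft] recognizes each summand
    as the operator of a grafted tree. *)
Lemma AF_gl_mul_tree T S :
  AF H (gl_mul_tree K T S) = (Dtree H T : op) \o Dtree H S :> op.
Proof.
rewrite /gl_mul_tree (linP_sum AF_linear) DtreeE [Dtree H S]DtreeE.
apply/funext => f /=; rewrite /branches.
case ES: (repr S) => [m b]; rewrite [pchildren (PNode _ _)]/=.
rewrite Bplus_Bgraft graft_sum_map graft_sum_ffun -(verticesE m).
rewrite op_sum; apply: eq_bigr => h _; rewrite AF_basis graftE Dtree_pi.
by rewrite Bplus_graft.
Qed.

Lemma AF_gl_mul x y : AF H (gl_mul x y) = (AF H x : op) \o AF H y :> op.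
Proof.
rewrite /gl_mul (linP_mlin _ _ AF_linear).
have -> : (AF H x : op) \o AF H y = mlin (fun T => (Dtree H T : op) \o AF H y : op) x.
  by rewrite -(linP_mlin (h := fun F : op => F \o AF H y : op)).
congr mlin; apply/funext => T; rewrite (linP_mlin _ _ AF_linear).
have lT : linear (fun F : op => (Dtree H T : op) \o F : op).
  move=> a F G; apply/funext => f; rewrite DtreeE.
  exact: (@Bplus_linear K k I).
rewrite /AF (linP_mlin _ _ lT); congr mlin; apply/funext => S.
exact: AF_gl_mul_tree.
Qed.

Section Hopf.
Variables (alpha : nat) (alpha_gt0 : (0 < alpha)%N) (W : pred nat).
Hypothesis HW : forall m i, W m -> ord_ge alpha (H m i).
Local Notation labW := (fun T : ptree => all W (plabels T)).
Local Notation allgood := (@vfields_ge K k I alpha).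

Lemma Ptree_ge T : labW T -> vfield_ge alpha (P T).
Proof.
elim/ptree_ind_mem: T => m s IHs; rewrite plabelsE => /andP[Wm Ws] i.
rewrite PtreeE; apply: (ord_ge_Bplus alpha_gt0); last exact: HW.
rewrite /vfields_ge all_map; apply/allP => U Us /=.
by apply/asboolP; apply: (IHs _ Us); exact: (allP Ws).
Qed.

Lemma map_Ptree_ge s : all labW s -> allgood (map P s).
Proof.
move=> Ws; rewrite /vfields_ge all_map; apply/allP => U Us.
by apply/asboolP/Ptree_ge/(allP Ws).
Qed.

Lemma branches_ge T : is_barT W T -> allgood (map P (branches T)).
Proof. by case/andP=> _; exact: map_Ptree_ge. Qed.

Lemma gl_coprod_treeE T : gl_coprod_tree K T =
  split_sum (fun a c => << (Bplus a, Bplus c) >>) (branches T).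
Proof. by rewrite split_sum_mask. Qed.

Lemma coprod_tree T : is_barT W T -> coprod_graph alpha (Dtree H T : op)
  (mlin (fun p : rtree * rtree => tens (AF H << p.1 >> : op) (AF H << p.2 >>))
     (gl_coprod_tree K T)).
Proof.
move=> bT; rewrite DtreeE; have := coprod_Bplus alpha_gt0 (branches_ge bT).
congr coprod_graph; rewrite /Bsplit split_sum_map gl_coprod_treeE.
rewrite (split_sum_morph _ _ (mlinD _)); apply: eq_split_sum => a c.
by rewrite mlin_basis /= !AF_basis !Dtree_Bplus.
Qed.

Lemma gl_counit_tree T : is_barT W T -> (T == Bplus [::]) = nilp (branches T).
Proof.
move=> bT; apply/eqP/nilP => [->|b0]; last by rewrite -[T](Bplus_branches bT) b0.
have [s' +] := branches_Bplus [::]; rewrite perm_sym => /perm_nilP -> st.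
by inversion st.
Qed.

(** * Compatibility with the antipode *)

Section Antipode.
Variable S : {malg K[rtree]} -> {malg K[rtree]}.
Hypothesis aS : gl_antipode W S.

Lemma in_GL_basis T : is_barT W T -> in_GL (K := K) W << T >>.
Proof. by move=> bT U /(fsubsetP msuppU_le); rewrite in_fset1 => /eqP->. Qed.

Lemma in_GL_lin (a : K) x y : in_GL W x -> in_GL W y -> in_GL W (a *: x + y).
Proof.
move=> Wx Wy T /(fsubsetP (msuppD_le _ _)); rewrite in_fsetU => /orP[|/Wy//].
by move=> /(fsubsetP (msuppZ_le _ _))/Wx.
Qed.

Lemma in_GL0 : in_GL (K := K) W 0.
Proof. by move=> T; rewrite msupp0 in_fset0. Qed.

(** [S] is linear on the elements of [in_GL W] only, so membership of the partial sums is carried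
    along. *)
Lemma antipode_mlin x : in_GL W x -> S x = mlin (fun T => S << T >>) x.
Proof.
case: aS => _ lS _ Wx; rewrite -{1}[x]mlin_id /mlin.
have S0 : S 0 = 0.
  have := lS (-1) 0 0 in_GL0 in_GL0.
  by rewrite scaler0 addr0 scaleN1r addNr.
suff [] : in_GL W (\sum_(t <- msupp x) x@_t *: (<< t >> : {malg K[rtree]})) /\
  S (\sum_(t <- msupp x) x@_t *: << t >>) = \sum_(t <- msupp x) x@_t *: S << t >> by [].
rewrite big_seq [X in S _ = X]big_seq.
apply: (big_rec2 (fun y z => in_GL W y /\ S y = z)) => [|T z y /Wx WT [Wy <-]].
  by split; [exact: in_GL0 | exact: S0].
split; first by apply: in_GL_lin => //; exact: in_GL_basis.
by rewrite lS //; exact: in_GL_basis.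
Qed.

Lemma AF_gl_conv T : AF H (gl_conv S id << T >>) =
  split_sum (fun a c => (AF H (S << Bplus a >>) : op) \o B (map P c) : op)
    (branches T) :> op.
Proof.
rewrite /gl_conv /gl_coprod mlin_basis gl_coprod_treeE.
rewrite (linP_mlin _ _ AF_linear) (split_sum_morph _ _ (mlinD _)).
apply: eq_split_sum => a c.
by rewrite mlin_basis AF_gl_mul AF_basis Dtree_Bplus.
Qed.

(** Both sides satisfy the same left convolution identity, [AF_gl_conv] turning that of [S] into one
    between operators; it determines the value at [s] from shorter lists. *)
Lemma AF_antipode s : all labW s ->
  AF H (S << Bplus s >>) = Banti (map P s) :> op.
Proof.
have [n sn] := ubnP (size s); elim: n s sn => // n IHn s sn Ws.
have [s' ss' s'b] := branches_Bplus s.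
have bT : is_barT W (Bplus s) by rewrite is_barT_Bplus.
have Wb : all labW (branches (Bplus s)) by case/andP: bT.
have Pb : map P (branches (Bplus s)) = map P s' by rewrite (Ptree_forest_iso s'b).
have sb : size (branches (Bplus s)) = size s.
  by rewrite -(size_map P) Pb size_map (perm_size ss').
rewrite (Banti_perm alpha_gt0 (map_Ptree_ge Ws) ss') -Pb.
pose F a c : op := (AF H (S << Bplus a >>) : op) \o B (map P c).
pose G a c : op := Banti (map P a) \o B (map P c).
have FG : split_sum F (branches (Bplus s)) = split_sum G (branches (Bplus s)).
  have -> : split_sum G (branches (Bplus s)) =
      split_sum (fun a c => Banti a \o B c : op) (map P (branches (Bplus s))).
    by rewrite split_sum_map.
  rewrite (Banti_conv alpha_gt0 (branches_ge bT)) -AF_gl_conv.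
  case: aS => _ _ /(_ _ (in_GL_basis bT))[-> _].
  rewrite (linPZ AF_linear) AF_basis Dtree_Bplus Bplus_nil /gl_counit mlin_basis.
  by rewrite gl_counit_tree // nilp_map.
(* All terms with a shorter left part agree by induction and cancel. *)
have {FG} : F (branches (Bplus s)) [::] = G (branches (Bplus s)) [::].
  move: FG; rewrite (split_sum_top F) (split_sum_top G) !split_sum_mono.
  rewrite [X in _ + X = _](split_sum_ext (P := labW) (G := fun a c =>
    if (size a < size (branches (Bplus s)))%N then G a c else 0)) //.
    exact: addIr.
  move=> a c Wa Wc _; case: ifP => // ab.
  by rewrite /F IHn // -ltnS (leq_trans _ sn) // -sb.
by rewrite /F /G Bplus_nil (Bplus_branches bT).
Qed.

End Antipode.

Lemma graph_mlin (V : lmodType K) (R : op -> V -> Prop) (F : rtree -> V) x :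
  (forall T, is_barT W T -> R (Dtree H T) (F T)) -> R 0 0 ->
  (forall a y z y' z', R y z -> R y' z' -> R (a *: y + y') (a *: z + z')) ->
  in_GL W x -> R (AF H x) (mlin F x).
Proof.
move=> RT R0 RL Wx; rewrite /AF /mlin big_seq [X in R _ X]big_seq.
by elim/big_rec2: _ => // T z y /Wx WT Ryz; apply: RL => //; exact: RT.
Qed.

Lemma AF_hopf : GL_hopf_morphism alpha W (AF H : {malg K[rtree]} -> op).
Proof.
split=> [x Wx|a x y _ _||x y _ _|x Wx|x Wx|S aS x Wx].
(* The predicate [diffop alpha] is treated as a relation with a dummy second argument. *)
- apply: (graph_mlin (V := K^o) (R := fun y _ => diffop alpha y) (F := fun=> 0)) => //.
  + by move=> T WT; rewrite DtreeE; exact: diffop_Bplus (branches_ge WT).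
  + exact: diffop0.
  + by move=> a y z y' z'; exact: diffop_lin.
- exact: AF_linear.
- by rewrite AF_basis Dtree_Bplus Bplus_nil.
- exact: AF_gl_mul.
- rewrite /gl_coprod (linP_mlin _ _ (mlin_linear _)).
  apply: (graph_mlin (R := coprod_graph alpha)) Wx => [T WT||a y z y' z'].
  + exact: coprod_tree.
  + exact: coprod_graph0.
  + exact: coprod_lin.
- apply: (graph_mlin (V := K^o) (R := counit_graph alpha)) Wx => [T WT||a y z y' z'].
  + rewrite DtreeE (gl_counit_tree WT) -(nilp_map P).
    exact: (counit_Bplus alpha_gt0 (branches_ge WT)).
  + exact: counit_graph0.
  + exact: counit_lin.
rewrite (antipode_mlin aS Wx) (linP_mlin _ _ AF_linear).
apply: (graph_mlin (R := antipode_graph alpha)) Wx => [T WT||a y z y' z'].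
- have <- := Bplus_branches WT; case/andP: (WT) => _ Wb.
  rewrite (AF_antipode aS) // Dtree_Bplus.
  exact: antipode_Bplus (map_Ptree_ge Wb).
- exact: antipode_graph0.
- exact: antipode_lin.
Qed.

End Hopf.
End TreeOperators.

Theorem theorem3p5 (K : comAlgType rat) (k : var_kind) (n alpha : nat)
    (W : pred nat) (H : nat -> 'I_n -> pseries K k 'I_n) :
  (0 < n)%N -> (0 < alpha)%N ->
  (exists m, W m) -> (forall m, W m -> (0 < m)%N) ->
  in_At alpha (fun i => @ts_var K k _ i - Ht W H i) ->
  GL_hopf_morphism alpha W (AF H).
Proof.
move=> _ alpha_gt0 _ _ [_ Hge _]; apply: AF_hopf => // m i Wm.
(* As z - (z - H_t) = H_t, the order condition on F_t bounds the coefficients of H_t. *)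
have := Hge i m; rewrite opprB addrC subrK.
by rewrite /Ht Wm.
Qed.
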